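(* Let $\hat\pi\in\operatorname{argmax}_{\pi\in\Pi}\min_{m\in\widehat{\mathcal M}_n(\alpha)}\{\hat V(\pi,m)-\hat V(\tilde\pi)\}$ be the empirical safe policy, where $\widehat{\mathcal M}_n(\alpha)$ is a data-dependent model class with $P(\mathcal M\subseteq\widehat{\mathcal M}_n(\alpha))\ge 1-\alpha$, and let $\pi^\ast\in\operatorname{argmax}_{\pi\in\Pi}V(\pi)$. Let $u(a)=u>0$ for all actions $a\in\mathcal A$. If the true conditional expectation satisfies $m^\ast\in\mathcal M$, then for any $0<\delta\le e^{-1}$, $$V(\pi^\ast)-V(\hat\pi)\ \le\ 2C\,\widehat{\mathcal W}_{\widehat{\mathcal M}_n(\alpha)}\big(\pi^\ast(1-\tilde\pi)\big)+6C(K-1)\left[\max_{a\in\mathcal A}\mathcal R_n(\Pi_a)+2\sqrt{\frac1n\log\frac{K-1}{\delta}}\right]$$ with probability at least $1-\alpha-\delta$, where $C=\max_{y\in\{0,1\},\,a\in\mathcal A}|u(y,a)|$.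
   Context: Setting. $\mathcal A=\{0,1,\dots,K-1\}$ ($K\ge2$) is a finite action set and $\mathcal X\subseteq\mathbb R^p$ a covariate space. Units $(\{Y_i(a)\}_{a\in\mathcal A},X_i)$, $i=1,\dots,n$, are i.i.d. copies of $(\{Y(a)\}_{a\in\mathcal A},X)$ with $X\in\mathcal X$ and $Y(a)\in\{0,1\}$. A (deterministic) policy is a map $\pi:\mathcal X\to\mathcal A$; write $\pi(x,a)=\mathbf 1\{\pi(x)=a\}$. $\tilde\pi$ is a known deterministic baseline policy; the observed data are $X_i$, the action $\tilde\pi(X_i)$, and $Y_i=Y_i(\tilde\pi(X_i))$; $Y=Y(\tilde\pi(X))$. $\Pi$ is a class of policies and $\Pi_a=\{\pi(\cdot,a):\pi\in\Pi\}$. Utility. $u(y,a)\in\mathbb R$ is the utility of outcome $y\in\{0,1\}$ under action $a$; $u(a)=u(1,a)-u(0,a)\ge0$ and $c(a)=u(0,a)$. Values. $m^\ast(a,x)=\mathbb E[Y(a)\mid X=x]$ and $\tilde m(x)=m^\ast(\tilde\pi(x),x)=\mathbb E[Y\mid X=x]$. For a function $m$ on $\mathcal A\times\mathcal X$, $$V(\pi,m)=\mathbb E\Big[\sum_{a\in\mathcal A}\pi(X,a)\{u(a)[\tilde\pi(X,a)Y+(1-\tilde\pi(X,a))m(a,X)]+c(a)\}\Big],$$ $$\hat V(\pi,m)=\frac1n\sum_{i=1}^n\sum_{a\in\mathcal A}\pi(X_i,a)\{u(a)[\tilde\pi(X_i,a)Y_i+(1-\tilde\pi(X_i,a))m(a,X_i)]+c(a)\}.$$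 $V(\pi)=V(\pi,m^\ast)$ for a fixed policy, and $V(\hat\pi)$ means this function evaluated at the data-dependent policy $\hat\pi$. $\hat V(\tilde\pi)=\hat V(\tilde\pi,m)$ does not depend on $m$. Model classes. $\mathcal F$ is a given class of functions $\mathcal A\times\mathcal X\to[0,1]$, and the restricted model class is $\mathcal M=\{f\in\mathcal F: f(\tilde\pi(x),x)=\tilde m(x)\ \forall x\in\mathcal X\}$. Empirical width. For a class $\mathcal H$ of functions on $\mathcal A\times\mathcal X$ and a function $g$ on $\mathcal A\times\mathcal X$, $$\widehat{\mathcal W}_{\mathcal H}(g)=\sup_{f\in\mathcal H}\frac1n\sum_{i=1}^n\sum_{a\in\mathcal A}f(a,X_i)g(a,X_i)-\inf_{f\in\mathcal H}\frac1n\sum_{i=1}^n\sum_{a\in\mathcal A}f(a,X_i)g(a,X_i),$$ and $\pi^\ast(1-\tilde\pi)$ denotes the function $(a,x)\mapsto\pi^\ast(x,a)(1-\tilde\pi(x,a))$. Rademacher complexity. For a class $\mathcal G$ of real functions on $\mathcal X$, $\mathcal R_n(\mathcal G)=\mathbb E\big[\sup_{g\in\mathcal G}\big|\frac1n\sum_{i=1}^n\varepsilon_i g(X_i)\big|\big]$, with $\varepsilon_i$ i.i.d. uniform on $\{-1,1\}$ independent of the $X_i$. The maximizers and minimizers in the definitions of $\hat\pi$ and $\pi^\ast$ are taken to exist. *)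

(* Defs.v *)
From HB Require Import structures.
From mathcomp Require Import all_boot all_order all_algebra.
From mathcomp Require Import all_classical all_reals all_analysis.
From mathcomp Require Import measurable_realfun.
Set Implicit Arguments.
Unset Strict Implicit.
Unset Printing Implicit Defensive.
Import Order.TTheory GRing.Theory Num.Theory.
Import numFieldNormedType.Exports.
Local Open Scope classical_set_scope.
Local Open Scope ring_scope.

(* "The event A has probability at least q".  For a measurable A this is just
   q <= P A; in general it bounds the inner probability of A. *)
Definition prob_at_least (R : realType) (d : measure_display)
    (Omega : measurableType d) (P : probability Omega R)
    (A : set Omega) (q : R) : Prop :=
  exists E : set Omega, [/\ measurable E, E `<=` A & (q%:E <= P E)%E].

(* Z_1, ..., Z_n are independent and each of them has the law of Z0. *)
Definition iid_copies (R : realType) (d d' : measure_display)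
    (Omega : measurableType d) (T : measurableType d')
    (P : probability Omega R) (n : nat)
    (Z : 'I_n -> Omega -> T) (Z0 : Omega -> T) : Prop :=
  (forall (J : {set 'I_n}) (B : 'I_n -> set T),
      (forall i, measurable (B i)) ->
      P (\bigcap_(i in [set` J]) (Z i @^-1` B i)) =
      (\prod_(i in J) P (Z i @^-1` B i))%E) /\
  (forall (i : 'I_n) (B : set T), measurable B ->
      P (Z i @^-1` B) = P (Z0 @^-1` B)).

(* m is (a version of) the regression function x |-> E[Y | X = x]. *)
Definition is_cond_mean (R : realType) (d d' : measure_display)
    (Omega : measurableType d) (X : measurableType d')
    (P : probability Omega R) (Xv : Omega -> X) (Y : Omega -> R)
    (m : X -> R) : Prop :=
  [/\ measurable_fun [set: X] m,
      P.-integrable [set: Omega] (fun w => (m (Xv w))%:E) &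
      forall B : set X, measurable B ->
        (\int[P]_(w in Xv @^-1` B) (m (Xv w))%:E =
         \int[P]_(w in Xv @^-1` B) (Y w)%:E)%E].

(* The expectation of f (S), as the infimum of E[h (S)] over the measurable
   majorants h of f.  It is the ordinary expectation as soon as f is
   measurable (outer_expectationE); the majorants give a meaning to the
   expectation of a supremum over an uncountable class. *)
Definition outer_expectation (R : realType) (d d' : measure_display)
    (Omega : measurableType d) (T : measurableType d')
    (P : probability Omega R) (S : Omega -> T) (f : T -> \bar R) : \bar R :=
  ereal_inf [set (\int[P]_w h (S w))%E | h in
    [set h : T -> \bar R |
       measurable_fun [set: T] h /\ forall t, (f t <= h t)%E]].

Lemma outer_expectationE (R : realType) (d d' : measure_display)
    (Omega : measurableType d) (T : measurableType d')
    (P : probability Omega R) (S : Omega -> T) (f : T -> \bar R) :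
  measurable_fun [set: Omega] S -> measurable_fun [set: T] f ->
  (forall t, 0 <= f t)%E ->
  outer_expectation P S f = (\int[P]_w f (S w))%E.
Proof.
move=> mS mf f0; apply/eqP; rewrite eq_le; apply/andP; split.
  by apply: ereal_inf_lbound; exists f.
apply: le_ereal_inf_tmp => _ [h [mh fh] <-].
have mhS : measurable_fun [set: Omega] (fun w => h (S w)).
  exact: measurableT_comp mh mS.
have mfS : measurable_fun [set: Omega] (fun w => f (S w)).
  exact: measurableT_comp mf mS.
by apply: ge0_le_integral => // w _; exact: le_trans (f0 _) (fh _).
Qed.

(* R_n(G).  The signs are uniform on the finite set {-1, 1}^n and independent
   of the covariates, so that integrating them out is averaging over the sign
   patterns eps (the sign of unit i being (-1) ^ eps i). *)
Definition rademacher_complexity (R : realType) (d d' : measure_display)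
    (Omega : measurableType d) (X : measurableType d')
    (P : probability Omega R) (n : nat) (Xs : 'I_n -> Omega -> X)
    (G : set (X -> R)) : \bar R :=
  ((2 ^- n : R)%:E *
   \sum_(eps : {ffun 'I_n -> bool})
     outer_expectation P (fun w => [tuple Xs i w | i < n])
       (fun xs : n.-tuple X =>
          ereal_sup [set `| n%:R^-1 *
              \sum_(i < n) (-1) ^+ eps i * g (tnth xs i) |%:E | g in G]))%E.

Definition is_minimum (R : realType) (A : set R) (v : R) : Prop :=
  A v /\ forall w, A w -> v <= w.

(* A unit is a pair z = (X, (Y(0), ..., Y(K-1))); only the coordinate
   Y = Y(pt X) of the potential outcomes is observed under the baseline pt. *)
Definition covariate (X : Type) (K : nat) (z : X * K.-tuple bool) : X := z.1.

Definition potential_outcome (X : Type) (K : nat) (a : 'I_K)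
    (z : X * K.-tuple bool) : bool := tnth z.2 a.

Definition outcome (X : Type) (K : nat) (pt : X -> 'I_K)
    (z : X * K.-tuple bool) : bool :=
  potential_outcome (pt (covariate z)) z.

(* One observed data point: covariate, baseline action, outcome. *)
Definition observation (X : Type) (K : nat) : Type := (X * 'I_K * bool)%type.

Definition observe (X : Type) (K : nat) (pt : X -> 'I_K)
    (z : X * K.-tuple bool) : observation X K :=
  (covariate z, pt (covariate z), outcome pt z).

Definition obs_x (X : Type) (K : nat) (o : observation X K) : X := o.1.1.
Definition obs_y (X : Type) (K : nat) (o : observation X K) : bool := o.2.

Definition measurable_policy (d : measure_display) (X : measurableType d)
    (K : nat) (pi : X -> 'I_K) : Prop :=
  forall a : 'I_K, measurable [set x | pi x = a].

Section Policies.
Variables (R : realType) (X : Type) (K : nat).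
Implicit Types (pi pt : X -> 'I_K) (m : 'I_K -> X -> R) (u : bool -> 'I_K -> R).

Definition pol pi (x : X) (a : 'I_K) : R := (pi x == a)%:R.

(* Pi_a *)
Definition policy_slice (Pi : set (X -> 'I_K)) (a : 'I_K) : set (X -> R) :=
  [set (fun x => pol pi x a) | pi in Pi].

(* u y a is the utility of the outcome y under the action a. *)
Definition util_diff u (a : 'I_K) : R := u true a - u false a.

Definition util_max u : R :=
  \big[Num.max/0]_(y : bool) \big[Num.max/0]_(a < K) `|u y a|.

Definition unit_value u pt pi m (x : X) (y : bool) : R :=
  \sum_(a < K) pol pi x a *
    (util_diff u a * (pol pt x a * y%:R + (1 - pol pt x a) * m a x)
     + u false a).

(* \hat V(pi, m) *)
Definition emp_value (n : nat) u pt (D : 'I_n -> observation X K) pi m : R :=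
  n%:R^-1 * \sum_(i < n) unit_value u pt pi m (obs_x (D i)) (obs_y (D i)).

(* x |-> m (pt x, x); for m the regression functions of the potential
   outcomes, this is E[Y | X = x]. *)
Definition baseline_mean pt m (x : X) : R := m (pt x) x.

Definition restricted_class (F : set ('I_K -> X -> R)) pt (mtilde : X -> R) :
    set ('I_K -> X -> R) :=
  [set f | F f /\ forall x, f (pt x) x = mtilde x].

Definition emp_width (n : nat) (xs : 'I_n -> X) (H : set ('I_K -> X -> R))
    (g : 'I_K -> X -> R) : \bar R :=
  let A := [set (n%:R^-1 *
      \sum_(i < n) \sum_(a < K) f a (xs i) * g a (xs i))%:E | f in H] in
  (ereal_sup A - ereal_inf A)%E.

(* pihat maximizes over Pi the worst case over M of the estimated improvement
   on pt; w pi is the worst case for pi, which is assumed to be attained. *)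
Definition is_emp_safe_policy (n : nat) u pt (D : 'I_n -> observation X K)
    (Pi : set (X -> 'I_K)) (M : set ('I_K -> X -> R)) (pihat : X -> 'I_K) :
    Prop :=
  Pi pihat /\
  exists w : (X -> 'I_K) -> R,
    (forall pi, Pi pi ->
       is_minimum
         [set emp_value u pt D pi m - emp_value u pt D pt m | m in M] (w pi)) /\
    (forall pi, Pi pi -> w pi <= w pihat).

End Policies.

(* V(pi, m); Z is a generic unit. *)
Definition value (R : realType) (d : measure_display)
    (Omega : measurableType d) (P : probability Omega R)
    (X : Type) (K : nat) (Z : Omega -> X * K.-tuple bool)
    (u : bool -> 'I_K -> R) (pt pi : X -> 'I_K) (m : 'I_K -> X -> R) : \bar R :=
  ('E_P[fun w =>
     unit_value u pt pi m (covariate (Z w)) (outcome pt (Z w))])%E.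

Definition is_optimal_policy (R : realType) (X : Type) (K : nat)
    (V : (X -> 'I_K) -> \bar R) (Pi : set (X -> 'I_K)) (pistar : X -> 'I_K) :
    Prop :=
  Pi pistar /\ forall pi, Pi pi -> (V pi <= V pistar)%E.

(* Main.v *)
Require Import Defs.
From HB Require Import structures.
From mathcomp Require Import all_boot all_order all_algebra.
From mathcomp Require Import all_classical all_reals all_analysis.
From mathcomp Require Import measurable_realfun ess_sup_inf.
From mathcomp Require Import ring lra.
Set Implicit Arguments.
Unset Strict Implicit.
Unset Printing Implicit Defensive.
Import Order.TTheory GRing.Theory Num.Theory.
Import numFieldNormedType.Exports.
Local Open Scope classical_set_scope.
Local Open Scope ring_scope.

(* When the true regression function mstar lies in the data-dependent class,
   maximality of pihat for the worst-case improvement gives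
     Vhat(pistar, mstar) - Vhat(pihat, mstar) <= ubar * width,
   so only the deviation of the empirical process indexed by v_pi - v_pistar is
   left, v_pi being the value of pi on one unit.  Its supremum over Pi need not
   be measurable, hence the argument is run on measurable functions that
   majorize every member of the family.  Symmetrization and contraction,
   performed one coordinate at a time, turn measurable majorants of the signed
   suprema of the outer Rademacher complexity into one of the process.  Clamping
   it to an interval of length c above its essential infimum in each coordinate
   makes its differences bounded everywhere without increasing its mean, and
   McDiarmid's inequality applies.  Splitting v_pi into all K actions, rather
   than the K - 1 non-reference ones, costs 2 C K <= 6 C (K - 1) and needs a
   single concentration event. *)

(** * Bounded measurable functions *)

Section BoundedMeasurable.
Context {R : realType} {d : measure_display} {T : measurableType d}.
Implicit Types (f g : T -> R) (mu : probability T R).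

(** Against a probability every such function is integrable, and the class is closed under the
    operations of the proof, so that real-valued integrals stay linear and monotone throughout. *)
Definition bounded_measurable f : Prop :=
  measurable_fun [set: T] f /\ exists M : R, forall x, `|f x| <= M.

Lemma bmfW f : bounded_measurable f -> measurable_fun [set: T] f.
Proof. by case. Qed.

Lemma bmf_cst (r : R) : bounded_measurable (fun=> r).
Proof. by split; [exact: measurable_cst | exists `|r|]. Qed.

Lemma bmfD f g : bounded_measurable f -> bounded_measurable g ->
  bounded_measurable (fun x => f x + g x).
Proof.
move=> [mf [M fM]] [mg [N gN]]; split; first exact: measurable_funD.
by exists (M + N) => x; apply: le_trans (ler_normD _ _) (lerD _ _).
Qed.

Lemma bmfM f g : bounded_measurable f -> bounded_measurable g ->
  bounded_measurable (fun x => f x * g x).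
Proof.
move=> [mf [M fM]] [mg [N gN]]; split; first exact: measurable_funM.
by exists (M * N) => x; rewrite normrM ler_pM.
Qed.

Lemma bmfZ (r : R) f : bounded_measurable f ->
  bounded_measurable (fun x => r * f x).
Proof. by move=> bf; apply: bmfM => //; exact: bmf_cst. Qed.

Lemma bmfB f g : bounded_measurable f -> bounded_measurable g ->
  bounded_measurable (fun x => f x - g x).
Proof.
move=> bf bg; have := bmfD bf (bmfZ (-1) bg).
by under eq_fun do rewrite mulN1r.
Qed.

Lemma bmf_sum (I : Type) (r : seq I) (p : pred I) (f : I -> T -> R) :
  (forall i, bounded_measurable (f i)) ->
  bounded_measurable (fun x => \sum_(i <- r | p i) f i x).
Proof.
move=> bf; elim: r => [|i r IH].
  by under eq_fun do rewrite big_nil; exact: bmf_cst.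
under eq_fun do rewrite big_cons.
case: (p i) => //; exact: bmfD.
Qed.

Lemma bmf_max f g : bounded_measurable f -> bounded_measurable g ->
  bounded_measurable (fun x => Num.max (f x) (g x)).
Proof.
move=> [mf [M fM]] [mg [N gN]]; split; first exact: measurable_maxr.
exists (M + N) => x; have := fM x; have := gN x.
have := normr_ge0 (f x); have := normr_ge0 (g x).
rewrite /Num.max; case: ifP => _; lra.
Qed.

Lemma bmf_min f g : bounded_measurable f -> bounded_measurable g ->
  bounded_measurable (fun x => Num.min (f x) (g x)).
Proof.
move=> [mf [M fM]] [mg [N gN]]; split; first exact: measurable_minr.
exists (M + N) => x; have := fM x; have := gN x.
have := normr_ge0 (f x); have := normr_ge0 (g x).
rewrite /Num.min; case: ifP => _; lra.
Qed.

Lemma bmf_expR f : bounded_measurable f ->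
  bounded_measurable (fun x => expR (f x)).
Proof.
move=> [mf [M fM]]; split; first exact: measurableT_comp.
exists (expR M) => x; rewrite ger0_norm ?expR_ge0// ler_expR.
exact: le_trans (ler_norm _) (fM x).
Qed.

Lemma bmf_integrable mu f : bounded_measurable f ->
  mu.-integrable [set: T] (EFin \o f).
Proof.
move=> [mf [M fM]]; apply: measurable_bounded_integrable => //.
  by rewrite -ge0_fin_numE// fin_num_measure.
exists M; split; first by rewrite num_real.
by move=> r Mr x _; exact: le_trans (fM x) (ltW Mr).
Qed.

Lemma bmf_int_fin mu f : bounded_measurable f ->
  (\int[mu]_x (f x)%:E)%E = (\int[mu]_x f x)%:E.
Proof.
by move=> bf; rewrite /Rintegral fineK//; apply: integrable_fin_num => //;
  exact: bmf_integrable.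
Qed.

Lemma bmf_int_cst mu (r : R) : \int[mu]_x r = r.
Proof.
rewrite Rintegral_cst// -[RHS]mulr1; congr (r * _).
exact: (congr1 fine (probability_setT mu)).
Qed.

Lemma bmf_intD mu f g : bounded_measurable f -> bounded_measurable g ->
  \int[mu]_x (f x + g x) = \int[mu]_x f x + \int[mu]_x g x.
Proof. by move=> bf bg; apply: RintegralD => //; exact: bmf_integrable. Qed.

Lemma bmf_intB mu f g : bounded_measurable f -> bounded_measurable g ->
  \int[mu]_x (f x - g x) = \int[mu]_x f x - \int[mu]_x g x.
Proof. by move=> bf bg; apply: RintegralB => //; exact: bmf_integrable. Qed.

Lemma bmf_intZ mu (r : R) f : bounded_measurable f ->
  \int[mu]_x (r * f x) = r * \int[mu]_x f x.
Proof. by move=> bf; apply: RintegralZl => //; exact: bmf_integrable. Qed.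

Lemma bmf_int_sum mu (I : Type) (r : seq I) (p : pred I) (f : I -> T -> R) :
  (forall i, bounded_measurable (f i)) ->
  \int[mu]_x (\sum_(i <- r | p i) f i x) = \sum_(i <- r | p i) \int[mu]_x f i x.
Proof.
move=> bf; elim: r => [|i r IH].
  by under eq_Rintegral do rewrite big_nil; rewrite big_nil bmf_int_cst.
under eq_Rintegral do rewrite big_cons.
rewrite big_cons; case: (p i) => //; rewrite bmf_intD ?IH//; exact: bmf_sum.
Qed.

Lemma bmf_int_le mu f g : bounded_measurable f -> bounded_measurable g ->
  (forall x, f x <= g x) -> \int[mu]_x f x <= \int[mu]_x g x.
Proof. by move=> bf bg fg; apply: le_Rintegral => //; exact: bmf_integrable. Qed.

Lemma bmf_int_le_cst mu f (r : R) : bounded_measurable f ->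
  (forall x, f x <= r) -> \int[mu]_x f x <= r.
Proof.
move=> bf fr; rewrite -[leRHS](bmf_int_cst mu).
by apply: bmf_int_le => //; exact: bmf_cst.
Qed.

Lemma bmf_int_ge_cst mu f (r : R) : bounded_measurable f ->
  (forall x, r <= f x) -> r <= \int[mu]_x f x.
Proof.
move=> bf fr; rewrite -[leLHS](bmf_int_cst mu).
by apply: bmf_int_le => //; exact: bmf_cst.
Qed.

End BoundedMeasurable.

Lemma bmf_comp {R : realType} {d d' : measure_display} {T : measurableType d}
    {T' : measurableType d'} (f : T -> R) (g : T' -> T) :
  bounded_measurable f -> measurable_fun [set: T'] g ->
  bounded_measurable (fun x => f (g x)).
Proof.
by move=> [mf [M fM]] mg; split; [exact: measurableT_comp | exists M].
Qed.

Lemma bmf_int_distribution {R : realType} {d d' : measure_display}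
    {T : measurableType d} {T' : measurableType d'} (P : probability T R)
    (X : {mfun T >-> T'}) (f : T' -> R) : bounded_measurable f ->
  \int[distribution P X]_y f y = \int[P]_x f (X x).
Proof.
move=> bf; rewrite /Rintegral integral_distribution//.
  by apply/measurable_EFinP; case: bf.
by apply: (@bmf_integrable _ _ _ _ (fun x => f (X x))); exact: bmf_comp.
Qed.

Lemma bmf_fubini {R : realType} {d d' : measure_display}
    {T : measurableType d} {T' : measurableType d'}
    (mu : probability T R) (mu' : probability T' R) (f : T * T' -> R) :
  bounded_measurable f ->
  \int[mu]_x \int[mu']_y f (x, y) = \int[(mu \x mu')%E]_z f z.
Proof.
move=> bf; rewrite /Rintegral; congr fine.
rewrite -integral12_prod_meas1; last exact: bmf_integrable.
apply: eq_integral => x _; rewrite /fubini_F.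
rewrite fineK//; apply: integrable_fin_num => //.
apply: (@bmf_integrable _ _ _ _ (fun y => f (x, y))).
by apply: bmf_comp => //; exact: measurable_fun_pair.
Qed.

Lemma bmf_int_snd {R : realType} {d d' : measure_display}
    {T : measurableType d} {T' : measurableType d'}
    (mu' : probability T' R) (f : T * T' -> R) :
  bounded_measurable f -> bounded_measurable (fun x => \int[mu']_y f (x, y)).
Proof.
move=> bf; have bf1 x : bounded_measurable (fun y => f (x, y)).
  by apply: bmf_comp => //; exact: measurable_fun_pair.
case: (bf) => mf [M fM]; split; last first.
  exists M => x; rewrite ler_norml; apply/andP; split.
    by apply: bmf_int_ge_cst => // y; have := fM (x, y); rewrite ler_norml => /andP[].
  by apply: bmf_int_le_cst => // y; have := fM (x, y); rewrite ler_norml => /andP[].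
apply/measurable_EFinP.
(* Tonelli's measurability applies to nonnegative integrands: shift by the bound [M], and subtract
   [M] after integrating. *)
pose g z := (f z + M)%:E.
have mg : measurable_fun [set: T * T'] g.
  by apply/measurable_EFinP; apply: measurable_funD.
have g0 z : (0 <= g z)%E.
  by rewrite lee_fin -lerBlDr sub0r; have := fM z; rewrite ler_norml => /andP[].
have := measurable_fun_fubini_tonelli_F (m2 := mu') g mg g0.
move=> mG.
rewrite [X in measurable_fun _ X](_ : _ = (fun x => fubini_F mu' g x - M%:E)%E).
  by apply: emeasurable_funB.
apply/funext => x /=; rewrite /fubini_F /g.
rewrite (bmf_int_fin _ (bmfD (bf1 x) (bmf_cst M))) bmf_intD//; last exact: bmf_cst.
by rewrite bmf_int_cst EFinD addeK.
Qed.

(** Exponential Markov inequality: the indicator of the event is bounded pointwise by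
    [expR (l * (h x - t))]. *)
Lemma bmf_chernoff {R : realType} {d : measure_display} {T : measurableType d}
    (mu : probability T R) (h : T -> R) (l t a : R) : 0 < l ->
  bounded_measurable h ->
  \int[mu]_x expR (l * h x) <= a ->
  (mu [set x | (t < h x)%R] <= (a * expR (- (l * t)))%:E)%E.
Proof.
move=> l0 bh ha.
have mA : measurable [set x | t < h x].
  rewrite -[X in measurable X]setTI.
  have -> : [set x | t < h x] = h @^-1` `]t, +oo[%classic.
    by apply/seteqP; split => x /=; rewrite in_itv/= andbT.
  exact: (bmfW bh).
have bi : bounded_measurable (\1_[set x | t < h x] : T -> R).
  split; first exact: measurable_indic.
  by exists 1 => x; rewrite ger0_norm// indicE lern1 leq_b1.
have be : bounded_measurable (fun x => expR (- (l * t)) * expR (l * h x)).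
  by apply: bmfZ; apply: bmf_expR; exact: bmfZ.
have -> : mu [set x | t < h x] =
    (\int[mu]_x (\1_[set x | (t < h x)%R] x)%:E)%E.
  by rewrite integral_indic// setIT.
rewrite bmf_int_fin// lee_fin.
apply: (@le_trans _ _ (\int[mu]_x (expR (- (l * t)) * expR (l * h x)))).
  apply: bmf_int_le => // x; rewrite indicE.
  have [|_] := boolP (x \in _); last by rewrite mulr_ge0 ?expR_ge0.
  rewrite inE/= => th; rewrite -expRD -expR0 ler_expR addrC subr_ge0.
  by rewrite ler_pM2l// ltW.
rewrite bmf_intZ; last by apply: bmf_expR; exact: bmfZ.
by rewrite mulrC ler_wpM2r// expR_ge0.
Qed.

(** * Resampling one coordinate *)

Definition set_tnth (T : Type) (n : nat) (s : n.-tuple T) (i : 'I_n) (t : T) :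
  n.-tuple T := [tuple if j == i then t else tnth s j | j < n].

Lemma tnth_set (T : Type) n (s : n.-tuple T) i t j :
  tnth (set_tnth s i t) j = if j == i then t else tnth s j.
Proof. by rewrite tnth_mktuple. Qed.

Lemma set_tnth_set (T : Type) n (s : n.-tuple T) i t t' :
  set_tnth (set_tnth s i t) i t' = set_tnth s i t'.
Proof. by apply: eq_from_tnth => j; rewrite !tnth_set; case: eqP. Qed.

Lemma set_tnthC (T : Type) n (s : n.-tuple T) i j t t' : i != j ->
  set_tnth (set_tnth s i t) j t' = set_tnth (set_tnth s j t') i t.
Proof.
move=> /negPf ij; apply: eq_from_tnth => k; rewrite !tnth_set.
by case: eqP => [->|//]; rewrite eq_sym ij.
Qed.

Section TupleMeasurability.
Context {d : measure_display} {T : measurableType d} {n : nat}.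

Definition set_tnth_pair (i : 'I_n) (p : n.-tuple T * T) : n.-tuple T :=
  set_tnth p.1 i p.2.

Lemma measurable_set_tnth (i : 'I_n) :
  measurable_fun [set: n.-tuple T * T] (set_tnth_pair i).
Proof.
apply/measurable_fun_tnthP => j.
rewrite [X in measurable_fun _ X](_ : _ =
  fun p => if j == i then p.2 else tnth p.1 j); last first.
  by apply/funext => p /=; rewrite tnth_set.
case: (j == i); first exact: measurable_snd.
exact: (measurableT_comp (measurable_tnth j) measurable_fst).
Qed.

HB.instance Definition _ (i : 'I_n) := isMeasurableFun.Build _ _ _ _
  (set_tnth_pair i) (measurable_set_tnth i).

Lemma measurable_set_tnth1 (s : n.-tuple T) (i : 'I_n) :
  measurable_fun [set: T] (set_tnth s i).
Proof.
rewrite (_ : set_tnth s i = set_tnth_pair i \o (fun t => (s, t))) //.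
by apply: measurableT_comp; [exact: measurable_set_tnth | exact: measurable_fun_pair].
Qed.

Definition rectangle (B : 'I_n -> set T) : set (n.-tuple T) :=
  [set s | forall i, B i (tnth s i)].

Lemma measurable_rectangle (B : 'I_n -> set T) :
  (forall i, measurable (B i)) -> measurable (rectangle B).
Proof.
move=> mB; rewrite (_ : rectangle B =
  \bigcap_(i in [set: 'I_n]) ((@tnth n T ^~ i) @^-1` B i)); last first.
  by apply/seteqP; split=> [s sB i _|s sB i]; [exact: sB | exact: (sB i)].
apply: fin_bigcap_measurable => // i _.
by rewrite -[X in measurable X]setTI; exact: measurable_tnth.
Qed.

(** Rectangles are a generating class stable under intersection, so a probability on tuples is
    determined by its values on them. *)
Lemma measurable_tuple_rectangles : measurable =
  <<s [set rectangle B | B in [set B | forall i, measurable (B i)]] >>.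
Proof.
apply/seteqP; split; last first.
  apply: smallest_sub; first exact: sigma_algebra_measurable.
  by move=> _ [B mB <-]; exact: measurable_rectangle.
apply: smallest_sub; first exact: smallest_sigma_algebra.
rewrite -bigcup_seq => A [i _ [B mB <-]].
apply: sub_sigma_algebra.
exists (fun j => if j == i then B else setT) => [j|]; first by case: ifP.
apply/seteqP; split=> s /=; last by move=> [_ sB] j; case: eqP => // ->.
by move=> /(_ i); rewrite eqxx.
Qed.

End TupleMeasurability.

Section Resampling.
Context {R : realType} {d : measure_display} {T : measurableType d} {n : nat}.
Variables (mu : probability T R) (nu : probability (n.-tuple T) R).

(** [nu] is the n-fold product of [mu], described on rectangles only, so that the law of the sample
    itself can play the role of [nu]. *)
Definition iid_law : Prop := forall B : 'I_n -> set T,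
  (forall i, measurable (B i)) -> nu (rectangle B) = (\prod_(i < n) mu (B i))%E.

Hypothesis pl : iid_law.

(** Under [iid_law], the conditional expectation of [h] given all coordinates but the i-th. *)
Definition avg_tnth (i : 'I_n) (h : n.-tuple T -> R) (s : n.-tuple T) : R :=
  \int[mu]_t h (set_tnth s i t).

Lemma bmf_set_tnth i (h : n.-tuple T -> R) s : bounded_measurable h ->
  bounded_measurable (fun t => h (set_tnth s i t)).
Proof. by move=> bh; apply: bmf_comp => //; exact: measurable_set_tnth1. Qed.

Lemma bmf_avg_tnth i (h : n.-tuple T -> R) : bounded_measurable h ->
  bounded_measurable (avg_tnth i h).
Proof.
move=> bh.
apply: (bmf_int_snd mu (f := fun p => h (set_tnth_pair i p))).
by apply: (@bmf_comp _ _ _ _ _ h) => //; exact: measurable_set_tnth.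
Qed.

(** Overwriting one coordinate by an independent draw preserves the product law: both measures agree
    on rectangles. *)
Lemma iid_law_resample i A : measurable A ->
  nu A = distribution (nu \x mu)%E (set_tnth_pair i) A.
Proof.
move=> mA.
apply: (measure_unique
  [set rectangle B | B in [set B : 'I_n -> set T | forall i, measurable (B i)]]
  (fun=> setT)) => //.
- exact: measurable_tuple_rectangles.
- move=> _ _ [B mB <-] [C mC <-]; exists (fun i => B i `&` C i).
    by move=> j; exact: measurableI.
  apply/seteqP; split=> [s sBC|s [sB sC] j]; last by split.
  by split=> j; have [] := sBC j.
- by move=> _; exists (fun=> setT) => //; apply/seteqP; split.
- by rewrite bigcup_const//; exists 0%N.
- move=> _ [B mB <-].
  (* The old i-th coordinate is overwritten and becomes unconstrained; [B i] constrains the fresh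
     draw instead. *)
  pose B' j := if j == i then setT else B j.
  have mB' j : measurable (B' j) by rewrite /B'; case: ifP.
  rewrite /distribution /pushforward /=.
  rewrite (_ : _ @^-1` _ = rectangle B' `*` B i); last first.
    apply/seteqP; split=> [[s t] /= sB|[s t] /= [sB tB] j].
      split=> [j|]; last by have := sB i; rewrite tnth_set eqxx.
      by have := sB j; rewrite tnth_set /B'; case: ifP.
    by rewrite tnth_set; case: eqP => [->//|/eqP/negPf ji]; have := sB j;
      rewrite /B' ji.
  rewrite [RHS]product_measure1E//; last exact: measurable_rectangle.
  transitivity ((\prod_(j < n) mu (B' j)) * mu (B i))%E; last first.
    by congr (_ * _)%E; exact/esym/pl.
  have muT : mu (B' i) = 1%E by rewrite /B' eqxx; exact: probability_setT.
  rewrite pl// (bigD1 i)//= [in RHS](bigD1 i)//= muT mul1e muleC.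
  by congr (_ * _)%E; apply: eq_bigr => j /negPf ji; rewrite /B' ji.
- by move=> _; rewrite -ge0_fin_numE// fin_num_measure.
Qed.

(** The tower property, from Fubini and the invariance under resampling. *)
Lemma int_avg_tnth i h : bounded_measurable h ->
  \int[nu]_s avg_tnth i h s = \int[nu]_s h s.
Proof.
move=> bh.
have bh' : bounded_measurable (fun p : n.-tuple T * T => h (set_tnth_pair i p)).
  by apply: (@bmf_comp _ _ _ _ _ h) => //; exact: measurable_set_tnth.
rewrite (bmf_fubini nu mu bh') -(bmf_int_distribution _ _ bh).
rewrite /Rintegral; congr fine; apply: eq_measure_integral => A mA _.
exact/esym/iid_law_resample.
Qed.

End Resampling.

(** * Bounded differences *)

(** The linear term disappears when [x] is a centred variable, leaving a sub-Gaussian bound. For x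
    >= 1 it follows from x <= x^2; below 1, from the rational bounds given by e^y (1 - y) <= 1. *)
Lemma expR_le_add_sqr {R : realType} (x : R) : expR x <= x + expR (x ^+ 2).
Proof.
have expB (y : R) : expR y * (1 - y) <= 1.
  have : expR y * (1 - y) <= expR y * expR (- y).
    by rewrite ler_wpM2l ?expR_ge0 ?expR_ge1Dx.
  by rewrite -expRD subrr expR0.
have [x1|x1] := leP 1 x.
  apply: (@le_trans _ _ (expR (x ^+ 2))); last lra.
  by rewrite ler_expR; nra.
have e0 := expR_gt0 x; have E0 := expR_gt0 (x ^+ 2).
have [x0|x0] := ltP x 0.
  have E1 := expR_ge1Dx (x ^+ 2); have := expB x => ex.
  suff : expR x <= x + (1 + x ^+ 2) by lra.
  rewrite -(@ler_pM2r _ (1 - x)); last lra.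
  apply: le_trans ex _; nra.
have E1 := expB (x ^+ 2); have := expB (x - x ^+ 2) => ex.
have ee : expR x = expR (x ^+ 2) * expR (x - x ^+ 2).
  by rewrite -expRD; congr expR; ring.
set E := expR (x ^+ 2) in E0 E1 ee *; set e := expR (x - x ^+ 2) in ex ee.
(* For 0 <= x < 1, multiplying the goal by 1 - x + x^2 and using [ex] reduces it to x times this
   inequality. *)
have EB : E * (1 - x) <= 1 - x + x ^+ 2.
  rewrite -(@ler_pM2r _ (1 + x)); last lra.
  have -> : E * (1 - x) * (1 + x) = E * (1 - x ^+ 2) by ring.
  apply: le_trans E1 _.
  have -> : (1 - x + x ^+ 2) * (1 + x) = 1 + x ^+ 3 by ring.
  by rewrite lerDl exprn_ge0.
have D0 : 0 < 1 - (x - x ^+ 2) by nra.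
rewrite ee -(@ler_pM2r _ (1 - (x - x ^+ 2)))// -mulrA.
apply: (@le_trans _ _ E); first by rewrite ger_pMr.
have : x * (E * (1 - x)) <= x * (1 - x + x ^+ 2) by rewrite ler_wpM2l.
nra.
Qed.

(** A form of Hoeffding's lemma: [f] stays within [c] of its mean, and [expR_le_add_sqr] is
    integrated at the centred variable [l * (f x - m)]. *)
Lemma mgf_oscillation {R : realType} {d : measure_display}
    {T : measurableType d} (mu : probability T R) (f : T -> R) (c l : R) :
  bounded_measurable f -> (forall x y, f x <= f y + c) ->
  \int[mu]_x expR (l * f x) <= expR (l * \int[mu]_x f x + (l * c) ^+ 2).
Proof.
move=> bf fc; set m := \int[mu]_x f x.
have fm x : `|f x - m| <= c.
  rewrite ler_norml; apply/andP; split.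
    have : m <= f x + c by apply: bmf_int_le_cst => // y; exact: fc.
    lra.
  have : f x - c <= m by apply: bmf_int_ge_cst => // y; have := fc x y; lra.
  lra.
have bl : bounded_measurable (fun x => l * (f x - m)).
  by apply: bmfZ; apply: bmfB => //; exact: bmf_cst.
have -> : \int[mu]_x expR (l * f x) =
    expR (l * m) * \int[mu]_x expR (l * (f x - m)).
  rewrite -bmf_intZ; last exact: bmf_expR.
  by apply: eq_Rintegral => x _; rewrite -expRD; congr expR; ring.
rewrite expRD ler_wpM2l ?expR_ge0//.
apply: (@le_trans _ _ (\int[mu]_x (l * (f x - m) + expR ((l * c) ^+ 2)))).
  apply: bmf_int_le => [||x]; [exact: bmf_expR|by apply: bmfD => //; exact: bmf_cst|].
  apply: le_trans (expR_le_add_sqr _) _; rewrite lerD2l ler_expR.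
  rewrite !exprMn ler_wpM2l ?sqr_ge0//.
  rewrite -(@real_normK _ (f x - m)) ?num_real//.
  by rewrite lerXn2r// nnegrE// (le_trans _ (fm x)).
rewrite bmf_intD//; last exact: bmf_cst.
rewrite bmf_int_cst bmf_intZ; last by apply: bmfB => //; exact: bmf_cst.
rewrite bmf_intB//; last exact: bmf_cst.
by rewrite bmf_int_cst subrr mulr0 add0r.
Qed.

Lemma bmf_int_le_ae {R : realType} {d : measure_display}
    {T : measurableType d} (mu : probability T R) (f g : T -> R) :
  bounded_measurable f -> bounded_measurable g ->
  {ae mu, forall x, f x <= g x} -> \int[mu]_x f x <= \int[mu]_x g x.
Proof.
move=> bf bg fg.
apply: (@le_trans _ _ (\int[mu]_x Num.max (f x) (g x))).
  apply: bmf_int_le => // [|x]; first exact: bmf_max.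
  by rewrite le_max lexx.
rewrite le_eqVlt; apply/orP; left; apply/eqP.
rewrite /Rintegral; congr fine; apply: ae_eq_integral => //.
- by apply/measurable_EFinP; apply: bmfW; exact: bmf_max.
- by apply/measurable_EFinP; exact: bmfW.
- by apply: filterS fg => x fgx _; rewrite max_r.
Qed.

Section BoundedDifferences.
Context {R : realType} {d : measure_display} {T : measurableType d} {n : nat}.
Variables (mu : probability T R) (nu : probability (n.-tuple T) R).
Hypothesis pl : iid_law mu nu.
Variable c : R.
Hypothesis c_gt0 : 0 < c.
Implicit Types (h l : n.-tuple T -> R) (i j : 'I_n) (r : seq 'I_n).

(** The one-sided inequality gives both directions, because [s] carries an arbitrary i-th
    coordinate. *)
Definition bounded_difference i h : Prop :=
  forall s t, h s <= h (set_tnth s i t) + c.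

Lemma bounded_difference_set i h s t t' : bounded_difference i h ->
  h (set_tnth s i t) <= h (set_tnth s i t') + c.
Proof. by move=> /(_ (set_tnth s i t) t'); rewrite set_tnth_set. Qed.

Lemma avg_tnth_set i h s t : avg_tnth mu i h (set_tnth s i t) = avg_tnth mu i h s.
Proof. by apply: eq_Rintegral => t' _; rewrite set_tnth_set. Qed.

Lemma avg_tnth_diff i j h : bounded_measurable h ->
  bounded_difference j h -> bounded_difference j (avg_tnth mu i h).
Proof.
move=> bh dh s t; have [<-|ij] := eqVneq i j.
  by rewrite avg_tnth_set lerDl ltW.
rewrite /avg_tnth -[X in _ + X](bmf_int_cst mu) -bmf_intD; last exact: bmf_cst.
  apply: bmf_int_le => [||t']; [exact: bmf_set_tnth | | ].
    by apply: bmfD; [exact: bmf_set_tnth | exact: bmf_cst].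
  by rewrite set_tnthC 1?eq_sym.
exact: bmf_set_tnth.
Qed.

Lemma foldr_avg_bmf r h : bounded_measurable h ->
  bounded_measurable (foldr (avg_tnth mu) h r).
Proof. by move=> bh; elim: r => //= i r IH; exact: bmf_avg_tnth. Qed.

Lemma foldr_avg_diff j r h : bounded_measurable h ->
  bounded_difference j h -> bounded_difference j (foldr (avg_tnth mu) h r).
Proof.
move=> bh dh; elim: r => //= i r IH; apply: avg_tnth_diff => //.
exact: foldr_avg_bmf.
Qed.

Lemma foldr_avg_set i r h s t : i \in r ->
  foldr (avg_tnth mu) h r (set_tnth s i t) = foldr (avg_tnth mu) h r s.
Proof.
elim: r s => //= j r IH s; rewrite inE; have [-> _|ij /= ir] := eqVneq i j.
  exact: avg_tnth_set.
by apply: eq_Rintegral => t' _; rewrite set_tnthC// IH.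
Qed.

Lemma foldr_avg_int r h : bounded_measurable h ->
  \int[nu]_s foldr (avg_tnth mu) h r s = \int[nu]_s h s.
Proof.
move=> bh; elim: r => //= i r <-; apply: int_avg_tnth => //.
exact: foldr_avg_bmf.
Qed.

(** Any tuple is reached from any other by overwriting the coordinates one at a time. *)
Lemma set_tnth_invariant_cst (A : Type) (f : n.-tuple T -> A) :
  (forall i s t, f (set_tnth s i t) = f s) -> forall s s', f s = f s'.
Proof.
move=> fi s s'.
pose upd r := foldr (fun i (z : n.-tuple T) => set_tnth z i (tnth s' i)) s r.
have -> : s' = upd (enum 'I_n).
  have updE r j : tnth (upd r) j = if j \in r then tnth s' j else tnth s j.
    elim: r => //= i r IH; rewrite tnth_set inE.
    by have [->|//] := eqVneq j i.
  by apply: eq_from_tnth => j; rewrite updE mem_enum.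
by elim: (enum _) => //= i r ->; rewrite fi.
Qed.

Lemma foldr_avg_enum h s : bounded_measurable h ->
  foldr (avg_tnth mu) h (enum 'I_n) s = \int[nu]_z h z.
Proof.
move=> bh; rewrite -(foldr_avg_int (enum 'I_n) bh).
rewrite -[LHS](bmf_int_cst nu); apply: eq_Rintegral => z _.
apply: set_tnth_invariant_cst => i s' t.
by apply: foldr_avg_set; rewrite mem_enum.
Qed.

(** The martingale step of McDiarmid's inequality: integrating coordinate [i] first and applying
    [mgf_oscillation] on its fibre, each further averaging costs a factor e^((a c)^2). *)
Lemma mgf_foldr_avg (a : R) r h : bounded_measurable h ->
  (forall i, bounded_difference i h) ->
  \int[nu]_s expR (a * h s) <=
  expR ((size r)%:R * (a * c) ^+ 2) *
    \int[nu]_s expR (a * foldr (avg_tnth mu) h r s).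
Proof.
move=> bh dh; elim: r => [|i r IH] /=; first by rewrite mul0r expR0 mul1r.
apply: le_trans IH _.
rewrite -natr1 mulrDl mul1r expRD -mulrA ler_wpM2l ?expR_ge0//.
set H := foldr _ _ _.
have bH : bounded_measurable H by exact: foldr_avg_bmf.
have dH : bounded_difference i H by exact: foldr_avg_diff.
have bE : bounded_measurable (fun s => expR (a * H s)).
  by apply: bmf_expR; exact: bmfZ.
have bA := bmf_avg_tnth mu i bH.
rewrite -(int_avg_tnth pl i bE) -bmf_intZ; last by apply: bmf_expR; exact: bmfZ.
apply: bmf_int_le => [||s].
- exact: bmf_avg_tnth.
- by apply: bmfZ; apply: bmf_expR; exact: bmfZ.
- rewrite -expRD addrC; apply: mgf_oscillation; first exact: bmf_set_tnth.
  by move=> t t'; exact: bounded_difference_set.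
Qed.

Lemma bounded_difference_mgf (a : R) h : bounded_measurable h ->
  (forall i, bounded_difference i h) ->
  \int[nu]_s expR (a * h s) <=
  expR (n%:R * (a * c) ^+ 2 + a * \int[nu]_s h s).
Proof.
move=> bh dh; apply: le_trans (mgf_foldr_avg a (enum 'I_n) bh dh) _.
rewrite size_enum_ord expRD ler_wpM2l ?expR_ge0//.
apply: bmf_int_le_cst => [|s].
  by apply: bmf_expR; apply: bmfZ; exact: foldr_avg_bmf.
by rewrite foldr_avg_enum.
Qed.

Lemma bounded_difference_tail (x : R) h : (0 < n)%N -> 0 < x ->
  bounded_measurable h -> (forall i, bounded_difference i h) ->
  (nu [set s | (\int[nu]_z h z + n%:R * (2 * c * x) < h s)%R] <=
   (expR (- (n%:R * x ^+ 2)))%:E)%E.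
Proof.
move=> n0 x0 bh dh.
(* At the exponent x / c the moment bound contributes n x^2 and the threshold - 2 n x^2. *)
have a0 : 0 < x / c by rewrite divr_gt0.
apply: le_trans
  (bmf_chernoff _ a0 bh (bounded_difference_mgf (x / c) bh dh)) _.
rewrite lee_fin -expRD ler_expR; rewrite le_eqVlt; apply/orP; left; apply/eqP.
by field; rewrite gt_eqF.
Qed.

End BoundedDifferences.

(** * Measurable majorants with bounded differences *)

Section Clamping.
Context {R : realType} {d : measure_display} {T : measurableType d} {n : nat}.
Variables (mu : probability T R) (nu : probability (n.-tuple T) R).
Hypothesis pl : iid_law mu nu.
Variable c : R.
Hypothesis c_gt0 : 0 < c.
Implicit Types (h l : n.-tuple T -> R) (i j : 'I_n) (r : seq 'I_n).
Implicit Type (L : set (n.-tuple T -> R)).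

(** The infimum over a fibre need not be measurable in the other coordinates; the essential infimum
    is. It is finite for bounded [h], so [fine] loses nothing. *)
Definition essinf_tnth i h (s : n.-tuple T) : R :=
  fine (ess_inf mu (fun t => (h (set_tnth s i t))%:E)).

Lemma essinf_tnthP i h s (a : R) : bounded_measurable h ->
  a <= essinf_tnth i h s <-> {ae mu, forall t, a <= h (set_tnth s i t)}.
Proof.
move=> [mh [M hM]].
have mu0 : (0 < mu [set: T])%E by rewrite [X in (_ < X)%E]probability_setT.
have fin : ess_inf mu (fun t => (h (set_tnth s i t))%:E) \is a fin_num.
  rewrite fin_numE; apply/andP; split.
    apply/eqP => E; have : ((- M)%:E <= -oo :> \bar R)%E.
      rewrite -E; apply: ess_inf_ler => t; rewrite lee_fin.
      by have := hM (set_tnth s i t); rewrite ler_norml => /andP[].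
    by rewrite leeNy_eq.
  apply/eqP => E; have : (+oo <= M%:E :> \bar R)%E.
    rewrite -E -(ess_inf_cst M%:E mu0); apply: le_ess_inf; apply: nearW => t /=.
    by rewrite lee_fin; have := hM (set_tnth s i t); rewrite ler_norml => /andP[].
  by rewrite leye_eq.
rewrite /essinf_tnth -lee_fin fineK//; split => [/ess_infP|H].
  by apply: filterS => t; rewrite lee_fin.
by apply/ess_infP; apply: filterS H => t; rewrite lee_fin.
Qed.

Lemma essinf_tnth_ae i h s : bounded_measurable h ->
  {ae mu, forall t, essinf_tnth i h s <= h (set_tnth s i t)}.
Proof. by move=> bh; apply/essinf_tnthP. Qed.

Lemma essinf_tnth_ge i h s (a : R) : bounded_measurable h ->
  (forall t, a <= h (set_tnth s i t)) -> a <= essinf_tnth i h s.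
Proof. by move=> bh ah; apply/essinf_tnthP => //; exact: nearW. Qed.

Lemma essinf_tnth_set i h s t :
  essinf_tnth i h (set_tnth s i t) = essinf_tnth i h s.
Proof.
by rewrite /essinf_tnth; under eq_fun do rewrite set_tnth_set.
Qed.

Lemma bmf_essinf_tnth i h : bounded_measurable h ->
  bounded_measurable (essinf_tnth i h).
Proof.
move=> bh; have [mh [M hM]] := bh; split; last first.
  exists M => s; rewrite ler_norml; apply/andP; split.
    apply: essinf_tnth_ge => // t.
    by have := hM (set_tnth s i t); rewrite ler_norml => /andP[].
  have := bmf_int_le_ae (bmf_cst _) (bmf_set_tnth i s bh) (essinf_tnth_ae i s bh).
  rewrite bmf_int_cst => /le_trans; apply.
  apply: bmf_int_le_cst => [|t']; first exact: bmf_set_tnth.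
  by have := hM (set_tnth s i t'); rewrite ler_norml => /andP[].
move=> _; apply: (measurability _ (RGenCInfty.measurableE R)) => //.
move=> _ [_ [a ->] <-]; rewrite setTI.
(* The essential infimum is at least [a] exactly when the section of [A] at [s] is null, and the
   measure of a section is measurable in [s]. *)
pose A : set (n.-tuple T * T) := (fun p => h (set_tnth_pair i p)) @^-1` `]-oo, a[%classic.
have mA : measurable A.
  rewrite -[X in measurable X]setTI.
  exact: (measurableT_comp mh (measurable_set_tnth i)).
rewrite (_ : _ @^-1` _ = (mu \o xsection A) @^-1` [set 0%E]).
  rewrite -[X in measurable X]setTI.
  by apply: (measurable_fun_xsection mu mA) => //; exact: emeasurable_set1.
have xA s : xsection A s = ~` [set t | a <= h (set_tnth s i t)].
  apply/seteqP; split=> t /=.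
    by rewrite /xsection/= inE /A/= in_itv/= ltNge => /negP.
  by move=> /negP; rewrite -ltNge /xsection/= inE /A/= in_itv/=.
apply/seteqP; split=> s /=; rewrite in_itv/= andbT.
  move/essinf_tnthP => /(_ bh) ae.
  by apply/negligibleP; [exact: measurable_xsection | rewrite xA].
move=> s0; apply/essinf_tnthP => //.
suff : mu.-negligible (xsection A s) by rewrite xA.
by apply/negligibleP => //; exact: measurable_xsection.
Qed.

(* In each fibre along coordinate i, h lies almost surely above its essential
   infimum, so that the clamping only decreases it there.  If moving coordinate
   i changes l <= h by at most c, then l - c is below h on the whole fibre, and
   l stays below the clamped function. *)
Definition clamp_tnth i h (s : n.-tuple T) : R :=
  Num.max (essinf_tnth i h s) (Num.min (h s) (essinf_tnth i h s + c)).

Lemma bmf_clamp_tnth i h : bounded_measurable h ->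
  bounded_measurable (clamp_tnth i h).
Proof.
move=> bh; have be := bmf_essinf_tnth i bh.
by apply: bmf_max => //; apply: bmf_min => //; apply: bmfD => //; exact: bmf_cst.
Qed.

Lemma clamp_tnth_ge i h l : bounded_measurable h ->
  bounded_difference c i l -> (forall s, l s <= h s) ->
  forall s, l s <= clamp_tnth i h s.
Proof.
move=> bh dl lh s; rewrite /clamp_tnth le_max; apply/orP; right.
rewrite le_min lh/= -lerBlDr; apply: essinf_tnth_ge => // t.
by rewrite lerBlDr (le_trans (dl s t))// lerD2r.
Qed.

Lemma clamp_tnth_diff i h : bounded_measurable h ->
  bounded_difference c i (clamp_tnth i h).
Proof.
move=> bh s t; rewrite /clamp_tnth essinf_tnth_set.
set e := essinf_tnth i h s.
apply: (@le_trans _ _ (e + c)).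
  by rewrite ge_max lerDl ltW//= ge_min lexx orbT.
by rewrite lerD2r le_max lexx.
Qed.

(** Moving coordinate [j] shifts both [h] and the essential infimum by at most [c], and max and min
    respect such shifts. Hence clamping one coordinate does not spoil those already clamped. *)
Lemma clamp_tnth_diffW i j h : bounded_measurable h ->
  bounded_difference c j h -> bounded_difference c j (clamp_tnth i h).
Proof.
move=> bh dh s t.
have [<-|ij] := eqVneq i j; first exact: clamp_tnth_diff.
have ed : essinf_tnth i h s <= essinf_tnth i h (set_tnth s j t) + c.
  rewrite -lerBlDr; apply/essinf_tnthP => //.
  apply: filterS (essinf_tnth_ae i s bh) => t' est'.
  rewrite lerBlDr (le_trans est')// -set_tnthC//; exact: dh.
have hd := dh s t.
rewrite /clamp_tnth ge_max; apply/andP; split.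
  by apply: le_trans ed _; rewrite lerD2r le_max lexx.
rewrite -lerBlDr le_max le_min; apply/orP; right.
by apply/andP; split; rewrite lerBlDr ge_min ?hd// lerD2r ed orbT.
Qed.

(** On each fibre the clamped function exceeds [h] at most on a null set, which averaging over
    coordinate [i] ignores. *)
Lemma clamp_tnth_int i h : bounded_measurable h ->
  \int[nu]_s clamp_tnth i h s <= \int[nu]_s h s.
Proof.
move=> bh; have bc := bmf_clamp_tnth i bh.
rewrite -(int_avg_tnth pl i bc) -(int_avg_tnth pl i bh).
apply: bmf_int_le => [||s]; [exact: bmf_avg_tnth..|].
apply: bmf_int_le_ae; [exact: bmf_set_tnth..|].
apply: filterS (essinf_tnth_ae i s bh) => t et.
by rewrite /clamp_tnth essinf_tnth_set ge_max et/= ge_min lexx.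
Qed.

Lemma bounded_difference_majorant L h : bounded_measurable h ->
  (forall l i, L l -> bounded_difference c i l) ->
  (forall l s, L l -> l s <= h s) ->
  exists h', [/\ bounded_measurable h', forall i, bounded_difference c i h',
    forall l s, L l -> l s <= h' s & \int[nu]_s h' s <= \int[nu]_s h s].
Proof.
move=> bh dL Lh; pose H r := foldr clamp_tnth h r.
have bH r : bounded_measurable (H r).
  by elim: r => //= i r IH; exact: bmf_clamp_tnth.
exists (H (enum 'I_n)); split => //.
- move=> i; have : i \in enum 'I_n by rewrite mem_enum.
  elim: (enum _) => //= j r IH; rewrite inE; have [-> _|_ /= /IH] := eqVneq i j.
    exact: clamp_tnth_diff.
  exact: clamp_tnth_diffW.
- move=> l s Ll; elim: (enum _) s => [|i r IH] s /=; first exact: Lh.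
  by apply: clamp_tnth_ge => //; exact: dL.
- by elim: (enum _) => //= i r IH; apply: le_trans (clamp_tnth_int _ _) IH.
Qed.

(** The event concerns the single majorant [h'], so it is measurable and serves all members of [L]
    at once. *)
Lemma majorant_concentration L h (x : R) : (0 < n)%N -> 0 < x ->
  bounded_measurable h -> (forall l i, L l -> bounded_difference c i l) ->
  (forall l s, L l -> l s <= h s) ->
  exists E : set (n.-tuple T), [/\ measurable E,
    (nu (~` E) <= (expR (- (n%:R * x ^+ 2)))%:E)%E &
    forall l s, L l -> E s -> l s <= \int[nu]_z h z + n%:R * (2 * c * x)].
Proof.
move=> n0 x0 bh dL Lh.
have [h' [bh' dh' Lh' h'h]] := bounded_difference_majorant bh dL Lh.
set y := \int[nu]_z h' z + n%:R * (2 * c * x).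
have mE : measurable [set s | h' s <= y].
  rewrite (_ : [set s | _] = h' @^-1` `]-oo, y]%classic).
    by rewrite -[X in measurable X]setTI; exact: (bmfW bh').
  by apply/seteqP; split => s /=; rewrite in_itv.
exists [set s | h' s <= y]; split => //.
  rewrite (_ : ~` _ = [set s | (y < h' s)%R]).
    exact: (bounded_difference_tail pl).
  by apply/seteqP; split => s /=; rewrite ltNge => /negP.
move=> l s Ll /= Es; apply: le_trans (Lh' _ s Ll) _; apply: le_trans Es _.
by rewrite lerD2r.
Qed.

End Clamping.

(** * Symmetrization and contraction *)

Section Symmetrization.
Context {R : realType} {d : measure_display} {T : measurableType d} {n : nat}.
Variables (mu : probability T R) (nu : probability (n.-tuple T) R).
Hypothesis pl : iid_law mu nu.
Notation signs := {ffun 'I_n -> bool}.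

Definition set_sign (eps : signs) (j : 'I_n) (b : bool) : signs :=
  [ffun i => if i == j then b else eps i].

(** The two patterns in each summand are [eps] and its flip at [j], and flipping is an
    involution. *)
Lemma sum_set_sign (j : 'I_n) (a : signs -> R) :
  \sum_eps (a (set_sign eps j false) + a (set_sign eps j true)) =
  2 * \sum_eps a eps.
Proof.
pose flip (eps : signs) := set_sign eps j (~~ eps j).
have flipK : involutive flip.
  move=> eps; apply/ffunP => i; rewrite !ffunE eqxx negbK.
  by case: eqP => [->|].
have aE eps : a (set_sign eps j false) + a (set_sign eps j true) =
    a eps + a (flip eps).
  have id : set_sign eps j (eps j) = eps.
    by apply/ffunP => i; rewrite ffunE; case: eqP => [->|].
  rewrite /flip; case: (eps j) id => -> //=; first exact: addrC.
under eq_bigr do rewrite aE.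
rewrite big_split/= [X in _ + X](_ : _ = \sum_eps a eps); first by ring.
by rewrite [RHS](reindex_inj (inv_inj flipK)).
Qed.

Variables (G : set (T -> R)) (q : T -> R) (Q : R).
Hypothesis Q_gt0 : 0 < Q.
Hypothesis bG : forall g, G g -> bounded_measurable g.
Hypothesis bq : bounded_measurable q.
Hypothesis qQ : forall t, `|q t| <= Q.

Let term (r : seq 'I_n) (eps : signs) (g : T -> R) (s : n.-tuple T) (i : 'I_n) : R :=
  if i \in r then q (tnth s i) * g (tnth s i) - \int[mu]_t (q t * g t)
  else 2 * Q * ((-1) ^+ eps i * g (tnth s i)).

Variable H0 : signs -> n.-tuple T -> R.
Hypothesis bH0 : forall eps, bounded_measurable (H0 eps).
Hypothesis H0_ge : forall g (eps : signs) s, G g ->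
  \sum_(i < n) (-1) ^+ eps i * g (tnth s i) <= H0 eps s.

(* The coordinates in r are already centred, the others still carry a sign.  A
   coordinate is processed by writing q t / Q = p t - (1 - p t): the majorants
   for the two signs, mixed with weights p and 1 - p, bound + q g at the sample
   point, and, mixed with exchanged weights and averaged over a fresh copy of
   the coordinate, they bound - E[q g]. *)
Lemma symmetrization_seq (r : seq 'I_n) : uniq r ->
  exists H : signs -> n.-tuple T -> R,
  [/\ forall eps, bounded_measurable (H eps),
      forall g (eps : signs) s, G g -> \sum_(i < n) term r eps g s i <= H eps s &
      \sum_eps \int[nu]_s H eps s = 2 * Q * \sum_eps \int[nu]_s H0 eps s].
Proof.
elim: r => [_|j r IH /= /andP[jr /IH[H [bH H_ge intH]]]].
  exists (fun eps s => 2 * Q * H0 eps s); split.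
  - by move=> eps; exact: bmfZ.
  - move=> g eps s Gg; rewrite /term /= -mulr_sumr.
    by rewrite ler_pM2l ?H0_ge// mulr_gt0.
  - by rewrite mulr_sumr; apply: eq_bigr => eps _; rewrite bmf_intZ.
pose p t := (1 + q t / Q) / 2.
have p01 t : 0 <= p t <= 1.
  have : `|q t / Q| <= 1.
    by rewrite normrM [`|Q^-1|]gtr0_norm ?invr_gt0// ler_pdivrMr// mul1r.
  rewrite ler_norml /p => /andP[? ?]; apply/andP; split; lra.
have bp : bounded_measurable p.
  rewrite /p; apply: bmfM; last exact: bmf_cst.
  apply: bmfD; first exact: bmf_cst.
  by apply: bmfM => //; exact: bmf_cst.
have bpj : bounded_measurable (fun s : n.-tuple T => p (tnth s j)).
  by apply: bmf_comp => //; exact: measurable_tnth.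
have bpj1 : bounded_measurable (fun s : n.-tuple T => 1 - p (tnth s j)).
  by apply: bmfB => //; exact: bmf_cst.
pose A eps s := p (tnth s j) * H (set_sign eps j false) s
  + (1 - p (tnth s j)) * H (set_sign eps j true) s.
pose B eps s := (1 - p (tnth s j)) * H (set_sign eps j false) s
  + p (tnth s j) * H (set_sign eps j true) s.
have bA eps : bounded_measurable (A eps) by apply: bmfD; exact: bmfM.
have bB eps : bounded_measurable (B eps) by apply: bmfD; exact: bmfM.
exists (fun eps s => 2^-1 * (A eps s + avg_tnth mu j (B eps) s)); split.
- by move=> eps; apply: bmfZ; apply: bmfD => //; exact: bmf_avg_tnth.
- move=> g eps s Gg.
  pose U := \sum_(i < n | i != j) term r eps g s i.
  have UE (eps' : signs) s' : (forall i, i != j -> eps' i = eps i) ->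
      (forall i, i != j -> tnth s' i = tnth s i) ->
      \sum_(i < n | i != j) term r eps' g s' i = U.
    by move=> ee ss; apply: eq_bigr => i ij; rewrite /term ee// ss.
  have HU (b : bool) s' : (forall i, i != j -> tnth s' i = tnth s i) ->
      2 * Q * ((-1) ^+ b * g (tnth s' j)) + U <= H (set_sign eps j b) s'.
    move=> ss; apply: le_trans (H_ge _ _ _ Gg).
    rewrite (bigD1 j)//= [X in _ <= _ + X]UE//; last first.
      by move=> i /negPf ij; rewrite ffunE ij.
    by rewrite {1}/term (negPf jr) ffunE eqxx.
  have HUf s' (ss : forall i, i != j -> tnth s' i = tnth s i) := HU false s' ss.
  have HUt s' (ss : forall i, i != j -> tnth s' i = tnth s i) := HU true s' ss.
  rewrite (bigD1 j)//= {1}/term inE eqxx /=.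
  rewrite [X in _ + X](_ : _ = U); last first.
    by apply: eq_bigr => i ij; rewrite /term inE (negPf ij).
  (* Mixing the signs + and - with weights p and 1 - p turns the factor 2 Q into 2 q. *)
  have pE t : 2 * Q * (2 * p t - 1) = 2 * q t.
    by rewrite /p; field; rewrite gt_eqF.
  have A_ge : U + 2 * (q (tnth s j) * g (tnth s j)) <= A eps s.
    have /andP[p0 p1] := p01 (tnth s j).
    have /(ler_wpM2l p0) := HUf s (fun _ _ => erefl).
    have p1' : 0 <= 1 - p (tnth s j) by rewrite subr_ge0.
    have /(ler_wpM2l p1') := HUt s (fun _ _ => erefl).
    rewrite /A mulrA -pE expr0 expr1; lra.
  have B_ge t : U - 2 * (q t * g t) <= B eps (set_tnth s j t).
    have ss i : i != j -> tnth (set_tnth s j t) i = tnth s i.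
      by move=> /negPf ij; rewrite tnth_set ij.
    have /andP[p0 p1] := p01 t.
    have p1' : 0 <= 1 - p t by rewrite subr_ge0.
    have := HUf _ ss; rewrite tnth_set eqxx => /(ler_wpM2l p1').
    have := HUt _ ss; rewrite tnth_set eqxx => /(ler_wpM2l p0).
    rewrite /B tnth_set eqxx mulrA -pE expr0 expr1; lra.
  have bqg : bounded_measurable (fun t => q t * g t).
    by apply: bmfM => //; exact: bG.
  have : U - 2 * \int[mu]_t (q t * g t) <= avg_tnth mu j (B eps) s.
    rewrite -[X in X - _](bmf_int_cst mu) -bmf_intZ// -bmf_intB//.
    + apply: bmf_int_le => //; last exact: bmf_set_tnth.
      by apply: bmfB; [exact: bmf_cst | exact: bmfZ].
    + exact: bmf_cst.
    + exact: bmfZ.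
  lra.
- have intE eps : \int[nu]_s (2^-1 * (A eps s + avg_tnth mu j (B eps) s)) =
      2^-1 * (\int[nu]_s H (set_sign eps j false) s
              + \int[nu]_s H (set_sign eps j true) s).
    have bBj := bmf_avg_tnth mu j (bB eps).
    rewrite bmf_intZ; last exact: bmfD.
    (* Averaging does not change the integral of [B], and in [A] + [B] the weights of each sign add
       up to one, so [p] cancels. *)
    rewrite bmf_intD// (int_avg_tnth pl)// -bmf_intD// -bmf_intD//.
    by congr (_ * _); apply: eq_Rintegral => s _; rewrite /A /B; ring.
  under eq_bigr do rewrite intE.
  rewrite -mulr_sumr (sum_set_sign j (fun eps => \int[nu]_s H eps s)).
  by rewrite mulrA mulVf ?mul1r// pnatr_eq0.
Qed.

(** Once every coordinate is centred the left side no longer depends on [eps], so the majorants may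
    be averaged over all sign patterns. The factor 2 comes from symmetrization and [Q] from
    contraction. *)
Lemma symmetrization_contraction : exists h : n.-tuple T -> R,
  [/\ bounded_measurable h,
      forall g s, G g -> \sum_(i < n)
        (q (tnth s i) * g (tnth s i) - \int[mu]_t (q t * g t)) <= h s &
      \int[nu]_s h s = 2 * Q * (2 ^- n * \sum_eps \int[nu]_s H0 eps s)].
Proof.
have [H [bH H_ge intH]] := symmetrization_seq (enum_uniq 'I_n).
have card_signs : \sum_(eps : signs) (1 : R) = 2 ^+ n.
  by rewrite sumr_const card_ffun card_bool card_ord natrX.
have n20 : (2 ^+ n : R) != 0 by rewrite expf_neq0// pnatr_eq0.
exists (fun s => 2 ^- n * \sum_eps H eps s); split.
- by apply: bmfZ; exact: bmf_sum.
- move=> g s Gg; set x := \sum_(i < n) _.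
  have xE : x = 2 ^- n * \sum_(eps : signs) x.
    by rewrite -[x in RHS]mul1r -mulr_suml card_signs mulKf.
  rewrite xE ler_pM2l ?invr_gt0 ?exprn_gt0// ler_sum// => eps _.
  apply: le_trans (H_ge _ eps _ Gg); apply: ler_sum => i _.
  by rewrite /term mem_enum.
- rewrite bmf_intZ; last exact: bmf_sum.
  by rewrite bmf_int_sum// intH; ring.
Qed.

End Symmetrization.

(** * Outer Rademacher complexity *)

Lemma outer_expectation_fin {R : realType} {d d' : measure_display}
    {Omega : measurableType d} {T : measurableType d'}
    (P : probability Omega R) (S : Omega -> T) (f : T -> \bar R) :
  (forall t, 0 <= f t <= 1)%E -> (0 <= outer_expectation P S f <= 1)%E.
Proof.
move=> f01; apply/andP; split.
  apply: le_ereal_inf_tmp => _ [h [mh fh] <-].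
  apply: integral_ge0 => w _; apply: le_trans (fh _).
  by have /andP[] := f01 (S w).
apply: ereal_inf_lbound; exists (cst 1%E).
  by split=> // t; have /andP[] := f01 t.
by rewrite integral_cst// mul1e; exact: probability_setT.
Qed.

(** The infimum need not be attained, whence the slack [eta]. Truncating a near-optimal majorant at
    1 keeps it above [f] and makes it real and bounded. *)
Lemma outer_expectation_majorant {R : realType} {d d' : measure_display}
    {Omega : measurableType d} {T : measurableType d'}
    (P : probability Omega R) (S : Omega -> T) (f : T -> \bar R) (eta : R) :
  measurable_fun [set: Omega] S -> 0 < eta ->
  (forall t, 0 <= f t <= 1)%E ->
  exists h : T -> R, [/\ bounded_measurable h, forall t, (f t <= (h t)%:E)%E &
    ((\int[P]_w h (S w))%:E <= outer_expectation P S f + eta%:E)%E].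
Proof.
move=> mS eta0 f01.
have /andP[of0 of1] := outer_expectation_fin P S f01.
have ofin : outer_expectation P S f \is a fin_num.
  by rewrite ge0_fin_numE// (le_lt_trans of1)// ltry.
have [_ [k [mk fk] <-] klt] := lb_ereal_inf_adherent eta0 ofin.
pose k1 t := mine (k t) 1%E.
have k1_01 t : (0 <= k1 t <= 1)%E.
  have /andP[f0 _] := f01 t.
  by rewrite /k1 le_min ge_min lexx orbT (le_trans f0 (fk t)) lee01.
have k1E t : k1 t = (fine (k1 t))%:E.
  have /andP[k0 kle] := k1_01 t.
  by rewrite fineK// ge0_fin_numE// (le_lt_trans kle)// ltry.
have mk1 : measurable_fun [set: T] k1 by exact: measurable_mine.
have bh : bounded_measurable (fun t => fine (k1 t)).
  split; first exact: (measurableT_comp _ mk1).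
  exists 1 => t; have := k1_01 t; rewrite k1E !lee_fin => /andP[? ?].
  by rewrite ger0_norm.
exists (fun t => fine (k1 t)); split => //.
  move=> t; rewrite -k1E /k1 le_min fk /=.
  by have /andP[] := f01 t.
rewrite -bmf_int_fin; last exact: (bmf_comp bh mS).
apply: le_trans (ltW klt); apply: ge0_le_integral => //.
- by move=> w _; rewrite -k1E; have /andP[] := k1_01 (S w).
- apply/measurable_EFinP; exact: (bmfW (bmf_comp bh mS)).
- exact: (measurableT_comp mk mS).
- by move=> w _; rewrite -k1E /k1 ge_min lexx.
Qed.

(** * The sample as a random tuple *)

Section Sample.
Context {d d' : measure_display} {Omega : measurableType d} {T : measurableType d'}.
Variables (n : nat) (Z : 'I_n -> {mfun Omega >-> T}).

Definition sample (w : Omega) : n.-tuple T := [tuple Z i w | i < n].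

Lemma measurable_sample : measurable_fun [set: Omega] sample.
Proof.
apply/measurable_fun_tnthP => i.
rewrite (_ : _ \o _ = Z i) //.
by apply/funext => w /=; rewrite tnth_mktuple.
Qed.

HB.instance Definition _ := isMeasurableFun.Build _ _ _ _ sample measurable_sample.

Lemma sample_iid_law {R : realType} (P : probability Omega R) (Z0 : {RV P >-> T}) :
  iid_copies P (fun i w => Z i w) Z0 ->
  iid_law (distribution P Z0) (distribution P sample).
Proof.
move=> [indep law] B mB.
transitivity (P (\bigcap_(i in [set` [set: 'I_n]%SET]) (Z i @^-1` B i))).
  congr (P _); apply/seteqP; split=> w /=.
    by move=> wB i _; have := wB i; rewrite tnth_mktuple.
  by move=> wB i; rewrite tnth_mktuple; apply: wB; rewrite /= inE.
rewrite indep//; under eq_bigl do rewrite inE.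
by apply: eq_bigr => i _; exact: law.
Qed.

End Sample.

Section Rademacher.
Context {R : realType} {dO dX dT : measure_display} {Omega : measurableType dO}
  {X : measurableType dX} {T : measurableType dT} (P : probability Omega R).
Variables (n : nat) (n_gt0 : (0 < n)%N) (Z : 'I_n -> {mfun Omega >-> T}).
Variables (x : T -> X) (mx : measurable_fun [set: T] x).
Variables (G : set (X -> R)) (G0 : G !=set0).
Hypothesis G01 : forall g t, G g -> 0 <= g t <= 1.

Let rad (eps : {ffun 'I_n -> bool}) (xs : n.-tuple X) : \bar R :=
  ereal_sup [set `| n%:R^-1 *
    \sum_(i < n) (-1) ^+ eps i * g (tnth xs i) |%:E | g in G].

Let rad01 eps xs : (0 <= rad eps xs <= 1)%E.
Proof.
have [g0 Gg0] := G0; apply/andP; split.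
  apply: (@le_trans _ _ (`| n%:R^-1 *
    \sum_(i < n) (-1) ^+ eps i * g0 (tnth xs i) |%:E)); first by rewrite lee_fin.
  by apply: ereal_sup_ubound; exists g0.
apply: ge_ereal_sup => _ [g Gg <-]; rewrite lee_fin normrM.
rewrite ger0_norm ?invr_ge0// mulrC ler_pdivrMr ?ltr0n// mul1r.
apply: le_trans (ler_norm_sum _ _ _) _.
have -> : n%:R = \sum_(i < n) (1 : R) by rewrite sumr_const card_ord.
apply: ler_sum => i _; rewrite normrM normrX normrN1 expr1n mul1r.
by have /andP[g_ge0 g_le1] := G01 (tnth xs i) Gg; rewrite ger0_norm.
Qed.

Let S w := [tuple x (Z i w) | i < n].

Let mS : measurable_fun [set: Omega] S.
Proof.
apply/measurable_fun_tnthP => i.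
rewrite (_ : _ \o _ = x \o Z i); first exact: measurableT_comp.
by apply/funext => w /=; rewrite tnth_mktuple.
Qed.

Let outer eps : R := fine (outer_expectation P S (rad eps)).

Let outerE eps : outer_expectation P S (rad eps) = (outer eps)%:E.
Proof.
have /andP[oe0 oe1] := outer_expectation_fin P S (rad01 eps).
by rewrite fineK// ge0_fin_numE// (le_lt_trans oe1)// ltry.
Qed.

Let rademacherE : rademacher_complexity P (fun i w => x (Z i w)) G =
  (2 ^- n * \sum_eps outer eps)%:E.
Proof.
rewrite /rademacher_complexity EFinM -sumEFin; congr (_ * _)%E.
by apply: eq_bigr => eps _; exact: outerE.
Qed.

Lemma rademacher_complexity01 :
  (0 <= rademacher_complexity P (fun i w => x (Z i w)) G <= 1)%E.
Proof.
have outer01 eps : 0 <= outer eps <= 1.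
  by have := outer_expectation_fin P S (rad01 eps); rewrite outerE !lee_fin.
rewrite rademacherE !lee_fin mulr_ge0 ?invr_ge0 ?exprn_ge0//=; last first.
  by apply: sumr_ge0 => eps _; have /andP[] := outer01 eps.
rewrite mulrC ler_pdivrMr ?exprn_gt0// mul1r.
have -> : 2 ^+ n = \sum_(eps : {ffun 'I_n -> bool}) (1 : R).
  by rewrite sumr_const card_ffun card_bool card_ord natrX.
by apply: ler_sum => eps _; have /andP[] := outer01 eps.
Qed.

(** Provides the [H0] of the symmetrization: one majorant per sign pattern, pulled back from
    covariates to units, with the factor n undoing the normalization. *)
Lemma rademacher_majorants (eta : R) : 0 < eta ->
  exists H : {ffun 'I_n -> bool} -> n.-tuple T -> R,
  [/\ forall eps, bounded_measurable (H eps),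
      forall g (eps : {ffun 'I_n -> bool}) s, G g ->
        \sum_(i < n) (-1) ^+ eps i * g (x (tnth s i)) <= H eps s &
      2 ^- n * \sum_eps \int[distribution P (sample Z)]_s H eps s <=
        n%:R * (fine (rademacher_complexity P (fun i w => x (Z i w)) G) + eta)].
Proof.
move=> eta0.
have /choice[h hP] :=
  fun eps => outer_expectation_majorant P mS eta0 (rad01 eps).
pose tx (s : n.-tuple T) : n.-tuple X := [tuple x (tnth s i) | i < n].
have mtx : measurable_fun [set: n.-tuple T] tx.
  apply/measurable_fun_tnthP => i.
  rewrite (_ : _ \o _ = x \o (@tnth n T)^~ i).
    by apply: measurableT_comp => //; exact: measurable_tnth.
  by apply/funext => s /=; rewrite tnth_mktuple.
have bh eps : bounded_measurable (h eps) by have [] := hP eps.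
have bhtx eps : bounded_measurable (fun s => h eps (tx s)) by exact: bmf_comp.
exists (fun eps s => n%:R * h eps (tx s)); split.
- by move=> eps; exact: bmfZ.
- move=> g eps s Gg; have [_ hge _] := hP eps.
  have : (rad eps (tx s) <= (h eps (tx s))%:E)%E := hge _.
  move=> /(le_trans (ereal_sup_ubound _)) => /(_ _ (ex_intro2 _ _ g Gg erefl)).
  rewrite lee_fin => /(le_trans (ler_norm _)).
  under eq_bigr do rewrite tnth_mktuple.
  by rewrite mulrC ler_pdivrMr ?ltr0n// mulrC.
- rewrite rademacherE/=.
  have int_le eps : \int[distribution P (sample Z)]_s (n%:R * h eps (tx s)) <=
      n%:R * (outer eps + eta).
    rewrite bmf_intZ// ler_pM2l ?ltr0n// bmf_int_distribution//.
    have [_ _] := hP eps; rewrite outerE -EFinD lee_fin; apply: le_trans.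
    rewrite le_eqVlt; apply/orP; left; apply/eqP.
    apply: eq_Rintegral => w _; congr (h eps _); apply: eq_from_tnth => i.
    by rewrite !tnth_mktuple.
  have n20 : (2 ^+ n : R) != 0 by rewrite expf_neq0// pnatr_eq0.
  have -> : n%:R * (2 ^- n * \sum_eps outer eps + eta) =
      2 ^- n * \sum_(eps : {ffun 'I_n -> bool}) (n%:R * (outer eps + eta)).
    rewrite -mulr_sumr big_split/= sumr_const card_ffun card_bool card_ord.
    by rewrite -[eta *+ _]mulr_natr natrX; field.
  by rewrite ler_pM2l ?invr_gt0 ?exprn_gt0// ler_sum.
Qed.

End Rademacher.

(** * Policies *)

Lemma int_tnth {R : realType} {d : measure_display} {T : measurableType d}
    {n : nat} (mu : probability T R) (nu : probability (n.-tuple T) R)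
    (f : T -> R) (i : 'I_n) :
  iid_law mu nu -> bounded_measurable f ->
  \int[nu]_s f (tnth s i) = \int[mu]_t f t.
Proof.
move=> pl bf; rewrite -(int_avg_tnth pl i); last first.
  by apply: bmf_comp => //; exact: measurable_tnth.
rewrite -[RHS](bmf_int_cst nu); apply: eq_Rintegral => s _.
by apply: eq_Rintegral => t _; rewrite tnth_set eqxx.
Qed.

Lemma sum_pol {R : realType} {X : Type} {K : nat} (pi : X -> 'I_K) (x : X)
    (f : 'I_K -> R) : \sum_(a < K) f a * pol R pi x a = f (pi x).
Proof.
rewrite (bigD1 (pi x))//= /pol eqxx mulr1 big1 ?addr0// => a.
by rewrite eq_sym => /negPf ->; rewrite mulr0.
Qed.

Lemma pol01 {R : realType} {X : Type} {K : nat} (pi : X -> 'I_K) x a :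
  0 <= pol R pi x a <= 1.
Proof. by rewrite /pol ler0n lern1 leq_b1. Qed.

Lemma bmf_pol {R : realType} {d : measure_display} {X : measurableType d}
    {K : nat} (pi : X -> 'I_K) (a : 'I_K) : measurable_policy pi ->
  bounded_measurable (fun x => pol R pi x a).
Proof.
move=> mpi; split; last first.
  by exists 1 => x; have /andP[p0 p1] := @pol01 R _ _ pi x a; rewrite ger0_norm.
rewrite (_ : (fun x => _) = \1_[set x | pi x = a]); first exact: measurable_indic.
apply/funext => x; rewrite indicE /pol; congr (nat_of_bool _)%:R.
by apply/eqP/idP; rewrite inE.
Qed.

Section PolicyValue.
Context {R : realType} {dX : measure_display} {X : measurableType dX} {K : nat}.
Variables (u : bool -> 'I_K -> R) (pt : X -> 'I_K) (m : 'I_K -> X -> R).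
Hypothesis mpt : measurable_policy pt.
Hypothesis mm : forall a, measurable_fun [set: X] (m a).
Hypothesis m01 : forall a x, 0 <= m a x <= 1.
Notation T := (X * K.-tuple bool)%type.

(** The coefficient of the slice of a policy at [a], free of that policy. The potential outcome of
    [a] may replace the observed one, since they agree wherever [pol R pt z.1 a] is nonzero. *)
Definition action_value (a : 'I_K) (z : T) : R :=
  util_diff u a * (pol R pt z.1 a * (tnth z.2 a)%:R
                   + (1 - pol R pt z.1 a) * m a z.1) + u false a.

Definition policy_value (pi : X -> 'I_K) (z : T) : R :=
  unit_value u pt pi m (covariate z) (outcome pt z).

Lemma policy_valueE pi z :
  policy_value pi z = \sum_(a < K) action_value a z * pol R pi z.1 a.
Proof.
apply: eq_bigr => a _; rewrite mulrC /action_value /outcome /potential_outcome.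
rewrite /covariate; congr ((_ * (_ + _) + _) * _).
by rewrite /pol; have [->|_] := eqVneq (pt z.1) a; rewrite ?mul0r.
Qed.

Lemma util_le_max y a : `|u y a| <= util_max u.
Proof.
rewrite /util_max; apply: le_trans (le_bigmax _ _ y).
exact: (le_bigmax _ (fun a => `|u y a|) a).
Qed.

Lemma action_value_le a z : `|action_value a z| <= util_max u.
Proof.
(* [b] is either a binary outcome or a value of [m], so the action value is a convex combination of
   two utilities. *)
set b := pol R pt z.1 a * (tnth z.2 a)%:R + (1 - pol R pt z.1 a) * m a z.1.
have /andP[b0 b1] : 0 <= b <= 1.
  rewrite /b /pol; case: (pt z.1 == a); last first.
    by rewrite mul0r add0r subr0 mul1r.
  by rewrite mul1r subrr mul0r addr0 ler0n lern1 leq_b1.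
rewrite (_ : action_value a z = b * u true a + (1 - b) * u false a); last first.
  by rewrite /action_value /util_diff -/b; ring.
apply: le_trans (ler_normD _ _) _; rewrite !normrM.
rewrite (ger0_norm b0) (ger0_norm (_ : 0 <= 1 - b)) ?subr_ge0//.
have := util_le_max true a; have := util_le_max false a; nra.
Qed.

Lemma bmf_action_value a : bounded_measurable (action_value a).
Proof.
split; last by exists (util_max u); exact: action_value_le.
have mp : measurable_fun [set: T] (fun z => pol R pt z.1 a).
  exact: (measurableT_comp (bmfW (bmf_pol a mpt)) measurable_fst).
have my : measurable_fun [set: T] (fun z => (tnth z.2 a)%:R : R).
  apply: (measurableT_comp (f := fun b : bool => b%:R : R)) => //.
  exact: (measurableT_comp (measurable_tnth a) measurable_snd).
apply: measurable_funD; last exact: measurable_cst.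
apply: measurable_funM; first exact: measurable_cst.
apply: measurable_funD; first exact: measurable_funM.
apply: measurable_funM; first exact: measurable_funB.
exact: measurableT_comp.
Qed.

Lemma bmf_policy_value pi : measurable_policy pi ->
  bounded_measurable (policy_value pi).
Proof.
move=> mpi; rewrite (_ : policy_value pi =
    fun z => \sum_(a < K) action_value a z * pol R pi z.1 a); last first.
  by apply/funext => z; exact: policy_valueE.
apply: bmf_sum => a; apply: bmfM; first exact: bmf_action_value.
exact: (bmf_comp (bmf_pol a mpi) measurable_fst).
Qed.

Lemma policy_value_le pi z : `|policy_value pi z| <= util_max u.
Proof.
rewrite policy_valueE (sum_pol pi z.1 (action_value ^~ z)).
exact: action_value_le.
Qed.

End PolicyValue.

(** * Uniform deviation over the policy class *)

Section PolicyDeviation.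
Context {R : realType} {dO dX : measure_display} {Omega : measurableType dO}
  {X : measurableType dX} {K n : nat} (P : probability Omega R).
Notation T := (X * K.-tuple bool)%type.
Variables (Z0 : {RV P >-> T}) (Z : 'I_n -> {RV P >-> T}).
Hypothesis n_gt0 : (0 < n)%N.
Hypothesis hZ : iid_copies P (fun i w => Z i w) Z0.
Variables (u : bool -> 'I_K -> R) (pt : X -> 'I_K) (m : 'I_K -> X -> R).
Hypothesis mpt : measurable_policy pt.
Hypothesis mm : forall a, measurable_fun [set: X] (m a).
Hypothesis m01 : forall a x, 0 <= m a x <= 1.
Variable Pi : set (X -> 'I_K).
Hypothesis mPi : forall pi, Pi pi -> measurable_policy pi.
Notation C := (util_max u).
Hypothesis C_gt0 : 0 < C.
Notation v := (policy_value u pt m).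

(* Only the pi-part of v pi - v pistar is symmetrized: the pistar-part enters the
   majorant as it is, and has mean zero. *)
Lemma policy_deviation (pistar : X -> 'I_K) (Rm x : R) : Pi pistar -> 0 < x ->
  (forall a, (rademacher_complexity P (fun i w => covariate (Z i w))
                (policy_slice Pi a) <= Rm%:E)%E) ->
  exists E : set Omega, [/\ measurable E,
    (P (~` E) <= (expR (- (n%:R * x ^+ 2)))%:E)%E &
    forall w pi, E w -> Pi pi ->
      (\int[P]_w' v pistar (Z0 w') - \int[P]_w' v pi (Z0 w'))
      - n%:R^-1 * \sum_(i < n) (v pistar (Z i w) - v pi (Z i w))
      <= 2 * C * K%:R * (Rm + x) + 8 * C * x].
Proof.
move=> Pstar x0 RmP.
have n0 : (n%:R : R) != 0 by rewrite pnatr_eq0 -lt0n.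
have ni0 : 0 < (n%:R^-1 : R) by rewrite invr_gt0 ltr0n.
pose mu := distribution P Z0; pose nu := distribution P (sample Z).
have pl : iid_law mu nu by exact: sample_iid_law.
pose q := action_value u pt m.
have bq a : bounded_measurable (q a) by exact: bmf_action_value.
have bv pi : Pi pi -> bounded_measurable (v pi).
  by move=> /mPi; exact: bmf_policy_value.
(* Replacing one unit changes one summand, bounded by 2 C in absolute value, of an average over
   n. *)
pose c := 4 * C / n%:R.
have c0 : 0 < c by rewrite /c divr_gt0 ?mulr_gt0 ?ltr0n.
pose G a : set (T -> R) := [set (fun z => pol R pi z.1 a) | pi in Pi].
have bG a g : G a g -> bounded_measurable g.
  move=> [pi Ppi <-].
  exact: (bmf_comp (bmf_pol a (mPi Ppi)) measurable_fst).
(* One majorant per action: [q a] is the contraction factor, bounded by C, and the slack [eta] is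
   taken equal to [x]. *)
have /choice[h hP] : forall a, exists h : n.-tuple T -> R,
    [/\ bounded_measurable h,
      forall pi s, Pi pi -> \sum_(i < n)
        (q a (tnth s i) * pol R pi (tnth s i).1 a
         - \int[mu]_t (q a t * pol R pi t.1 a)) <= h s &
      \int[nu]_s h s <= 2 * C * (n%:R * (Rm + x))].
  move=> a.
  have slice01 (g : X -> R) t : policy_slice Pi a g -> 0 <= g t <= 1.
    by move=> [pi _ <-]; exact: pol01.
  have slice0 : (policy_slice Pi a : set (X -> R)) !=set0.
    by exists (fun y => pol R pistar y a); exists pistar.
  have mcov : measurable_fun [set: T] (@covariate X K) by exact: measurable_fst.
  have [H [bH H_ge intH]] :=
    rademacher_majorants P n_gt0 Z mcov slice0 slice01 x0.
  have H_ge' g (eps : {ffun 'I_n -> bool}) s : G a g ->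
      \sum_(i < n) (-1) ^+ eps i * g (tnth s i) <= H eps s.
    by move=> [pi Ppi <-]; apply: (H_ge (fun y => pol R pi y a)); exists pi.
  have [h [bh h_ge inth]] := symmetrization_contraction pl C_gt0 (bG a) (bq a)
    (action_value_le u pt m01 a) bH H_ge'.
  exists h; split => //.
    by move=> pi s Ppi; apply: (h_ge (fun z => pol R pi z.1 a)); exists pi.
  rewrite inth ler_pM2l ?mulr_gt0//; apply: le_trans intH _.
  rewrite ler_pM2l ?ltr0n// lerD2r.
  have /andP[r0 r1] :=
    rademacher_complexity01 P n_gt0 Z (@covariate X K) slice0 slice01.
  by rewrite -lee_fin fineK ?RmP// ge0_fin_numE// (le_lt_trans r1)// ltry.
have bh a : bounded_measurable (h a) by have [] := hP a.
pose D pi z := v pi z - v pistar z.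
have bD pi : Pi pi -> bounded_measurable (D pi) by move=> Ppi; apply: bmfB; exact: bv.
have D_le pi z : `|D pi z| <= 2 * C.
  have := policy_value_le u pt m01 pi z.
  have := policy_value_le u pt m01 pistar z.
  rewrite !ler_norml /D => /andP[? ?] /andP[? ?]; apply/andP; split; lra.
pose l pi (s : n.-tuple T) :=
  n%:R^-1 * \sum_(i < n) (D pi (tnth s i) - \int[mu]_t D pi t).
pose L : set (n.-tuple T -> R) := [set l pi | pi in Pi].
pose V := \int[mu]_t v pistar t.
pose H s := n%:R^-1 *
  (\sum_(a < K) h a s - \sum_(i < n) (v pistar (tnth s i) - V)).
have bvi i : bounded_measurable (fun s : n.-tuple T => v pistar (tnth s i)).
  by apply: bmf_comp; [exact: bv | exact: measurable_tnth].
have bviV i : bounded_measurable (fun s : n.-tuple T => v pistar (tnth s i) - V).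
  by apply: bmfB => //; exact: bmf_cst.
have bS : bounded_measurable (fun s => \sum_(a < K) h a s) by exact: bmf_sum.
have bSv : bounded_measurable
    (fun s : n.-tuple T => \sum_(i < n) (v pistar (tnth s i) - V)).
  exact: bmf_sum.
have bH : bounded_measurable H by apply: bmfZ; exact: bmfB.
have dL f i : L f -> bounded_difference c i f.
  move=> [pi Ppi <-] s t; rewrite /l /c (bigD1 i)//= [in leRHS](bigD1 i)//=.
  rewrite tnth_set eqxx.
  rewrite [in leRHS](eq_bigr
    (fun j => D pi (tnth s j) - \int[mu]_t D pi t)); last first.
    by move=> j /negPf ji; rewrite tnth_set ji.
  rewrite [4 * C / _]mulrC -mulrDr ler_pM2l//.
  have := D_le pi (tnth s i); have := D_le pi t.
  rewrite !ler_norml => /andP[? ?] /andP[? ?]; lra.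
have LH f s : L f -> f s <= H s.
  move=> [pi Ppi <-]; rewrite /l /H ler_pM2l//.
  have -> : \sum_(i < n) (D pi (tnth s i) - \int[mu]_t D pi t) =
      \sum_(i < n) (v pi (tnth s i) - \int[mu]_t v pi t)
      - \sum_(i < n) (v pistar (tnth s i) - V).
    rewrite -sumrB; apply: eq_bigr => i _.
    by rewrite bmf_intB; [rewrite /D /V; ring | exact: bv..].
  rewrite lerD2r.
  have -> : \sum_(i < n) (v pi (tnth s i) - \int[mu]_t v pi t) =
      \sum_(a < K) \sum_(i < n) (q a (tnth s i) * pol R pi (tnth s i).1 a
         - \int[mu]_t (q a t * pol R pi t.1 a)).
    rewrite exchange_big/=; apply: eq_bigr => i _; rewrite sumrB.
    rewrite policy_valueE -bmf_int_sum; last first.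
      move=> a; apply: bmfM => //.
      exact: (bmf_comp (bmf_pol a (mPi Ppi)) measurable_fst).
    by congr (_ - _); apply: eq_Rintegral => t _; rewrite policy_valueE.
  by apply: ler_sum => a _; have [_ hge _] := hP a; exact: hge.
have intH : \int[nu]_s H s <= 2 * C * K%:R * (Rm + x).
  rewrite bmf_intZ; last exact: bmfB.
  rewrite bmf_intB// !bmf_int_sum// [X in _ - X]big1 ?subr0; last first.
    move=> i _; rewrite bmf_intB//; last exact: bmf_cst.
    by rewrite bmf_int_cst (int_tnth i pl) ?subrr//; exact: bv.
  apply: (@le_trans _ _ (n%:R^-1 *
      \sum_(a < K) (2 * C * (n%:R * (Rm + x))))).
    by rewrite ler_pM2l// ler_sum// => a _; have [] := hP a.
  rewrite sumr_const card_ord -mulr_natr le_eqVlt; apply/orP; left; apply/eqP.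
  by field.
have [E [mE PE E_le]] := majorant_concentration pl c0 n_gt0 x0 bH dL LH.
exists (sample Z @^-1` E); split => //.
  by rewrite -[X in measurable X]setTI; exact: measurable_sample.
move=> w pi Ew Ppi.
have := E_le (l pi) (sample Z w) (ex_intro2 _ _ pi Ppi erefl) Ew.
move=> /le_trans => /(_ (2 * C * K%:R * (Rm + x) + 8 * C * x)).
have -> : n%:R * (2 * c * x) = 8 * C * x by rewrite /c; field.
rewrite lerD2r => /(_ intH); apply: le_trans.
rewrite /l [in leRHS]sumrB sumr_const card_ord -mulr_natr bmf_intB; [|exact: bv..].
rewrite !bmf_int_distribution; [|exact: bv..].
rewrite le_eqVlt; apply/orP; left; apply/eqP.
rewrite [in RHS](eq_bigr (fun i => - (v pistar (Z i w) - v pi (Z i w)))); last first.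
  by move=> i _; rewrite /sample tnth_mktuple /D opprB.
by rewrite sumrN; field.
Qed.

End PolicyDeviation.

(** * Regret on the sample and the empirical width *)

Section EmpiricalRegret.
Context {R : realType} {X : Type} {K n : nat}.
Variables (u : bool -> 'I_K -> R) (pt : X -> 'I_K) (D : 'I_n -> observation X K).

(** The model is multiplied by [pol] times 1 - [pol] of the same policy, which vanishes. *)
Lemma emp_value_baseline m m' : emp_value u pt D pt m = emp_value u pt D pt m'.
Proof.
congr (_ * _); apply: eq_bigr => i _; apply: eq_bigr => a _.
by rewrite /pol; case: (_ == a); rewrite ?mul0r// subrr !mul0r.
Qed.

Lemma emp_valueB (ubar : R) pi m m' : (forall a, util_diff u a = ubar) ->
  emp_value u pt D pi m - emp_value u pt D pi m' =
  ubar * (n%:R^-1 * \sum_(i < n) \sum_(a < K) m a (obs_x (D i)) *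
            (pol R pi (obs_x (D i)) a * (1 - pol R pt (obs_x (D i)) a))
          - n%:R^-1 * \sum_(i < n) \sum_(a < K) m' a (obs_x (D i)) *
            (pol R pi (obs_x (D i)) a * (1 - pol R pt (obs_x (D i)) a))).
Proof.
move=> hu; rewrite /emp_value -!mulrBr mulrCA; congr (_ * _).
rewrite -!sumrB mulr_sumr; apply: eq_bigr => i _.
rewrite -!sumrB mulr_sumr; apply: eq_bigr => a _.
by rewrite hu; ring.
Qed.

(** Let [m0] be the worst case for [pistar]. The improvement of [pihat] under [m] is at least its
    worst case, hence at least that of [pistar], attained at [m0]. The regret is thus at most the
    change in the value of [pistar] between [m] and [m0]. *)
Lemma emp_regret_width (ubar : R) (Pi : set (X -> 'I_K))
    (M : set ('I_K -> X -> R)) pihat pistar m :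
  0 < ubar -> (forall a, util_diff u a = ubar) ->
  is_emp_safe_policy u pt D Pi M pihat -> Pi pistar -> M m ->
  ((emp_value u pt D pistar m - emp_value u pt D pihat m)%:E <=
   ubar%:E * emp_width (fun i => obs_x (D i)) M
     (fun a x => pol R pistar x a * (1 - pol R pt x a))%R)%E.
Proof.
move=> u0 hu [Phat [w [wmin wmax]]] Pstar Mm.
have [[m0 Mm0 wE] _] := wmin _ Pstar.
have [_ hat_le] := wmin _ Phat.
have := hat_le _ (ex_intro2 _ _ m Mm erefl).
have := wmax _ Pstar; rewrite -wE (emp_value_baseline m m0) => h1 h2.
apply: (@le_trans _ _
  (emp_value u pt D pistar m - emp_value u pt D pistar m0)%:E).
  by rewrite lee_fin; lra.
rewrite (emp_valueB pistar m m0 hu) EFinM lee_pmul2l// ?lte_fin// EFinB.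
by apply: leeB; [apply: ereal_sup_ubound | apply: ereal_inf_lbound];
  [exists m | exists m0].
Qed.

(** Allows the factor [ubar] of the width to be enlarged to 2 C. *)
Lemma emp_width_ge0 (xs : 'I_n -> X) (M : set ('I_K -> X -> R))
    (g : 'I_K -> X -> R) : M !=set0 -> (0 <= emp_width xs M g)%E.
Proof.
move=> [m Mm]; rewrite /emp_width.
set a := (n%:R^-1 * \sum_(i < n) \sum_(b < K) m b (xs i) * g b (xs i))%:E.
rewrite -(@subee _ a)//; apply: leeB.
  by apply: ereal_sup_ubound; exists m.
by apply: ereal_inf_lbound; exists m.
Qed.

End EmpiricalRegret.

(** * Assembling the regret bound *)

Lemma util_diff_le_max {R : realType} {K : nat} (u : bool -> 'I_K -> R) a :
  util_diff u a <= 2 * util_max u.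
Proof.
have := util_le_max u true a; have := util_le_max u false a.
rewrite /util_diff !ler_norml => /andP[? ?] /andP[? ?]; lra.
Qed.

Lemma valueE {R : realType} {d dX : measure_display} {Omega : measurableType d}
    {X : measurableType dX} {K : nat} (P : probability Omega R)
    (Z : {RV P >-> (X * K.-tuple bool)%type}) (u : bool -> 'I_K -> R)
    (pt pi : X -> 'I_K) (m : 'I_K -> X -> R) :
  bounded_measurable (policy_value u pt m pi) ->
  value P Z u pt pi m = (\int[P]_w policy_value u pt m pi (Z w))%:E.
Proof.
move=> bv; rewrite /value unlock.
by rewrite -bmf_int_fin//; exact: bmf_comp.
Qed.

Theorem theorem2 (R : realType) (dO dX : measure_display)
    (Omega : measurableType dO) (P : probability Omega R)
    (X : measurableType dX) (K n : nat) (hK : (1 < K)%N) (hn : (0 < n)%N)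
    (* generic unit and i.i.d. sample *)
    (Z0 : {RV P >-> (X * K.-tuple bool)%type})
    (Z : 'I_n -> {RV P >-> (X * K.-tuple bool)%type})
    (hZ : iid_copies P (fun i w => Z i w) Z0)
    (* utility, with u(a) = ubar > 0 for all actions *)
    (u : bool -> 'I_K -> R) (ubar : R) (hubar : 0 < ubar)
    (hu : forall a, util_diff u a = ubar)
    (* baseline policy and policy class *)
    (pt : X -> 'I_K) (hpt : measurable_policy pt)
    (Pi : set (X -> 'I_K)) (hPi : forall pi, Pi pi -> measurable_policy pi)
    (* model class and true regression functions *)
    (F : set ('I_K -> X -> R))
    (hF : forall f, F f -> forall a x, 0 <= f a x <= 1)
    (mstar : 'I_K -> X -> R)
    (hmstar : forall a, is_cond_mean P (fun w => covariate (Z0 w))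
                (fun w => (potential_outcome a (Z0 w))%:R) (mstar a))
    (hM : restricted_class F pt (baseline_mean pt mstar) mstar)
    (* data-dependent model class *)
    (alpha : R)
    (Mhat : ('I_n -> observation X K) -> set ('I_K -> X -> R))
    (hMhat : prob_at_least P
       [set w | restricted_class F pt (baseline_mean pt mstar)
                  `<=` Mhat (fun i => observe pt (Z i w))] (1 - alpha))
    (* empirical safe policy and optimal policy *)
    (pihat : ('I_n -> observation X K) -> X -> 'I_K)
    (hpihat : forall w, let D := fun i => observe pt (Z i w) in
       is_emp_safe_policy u pt D Pi (Mhat D) (pihat D))
    (pistar : X -> 'I_K)
    (hpistar : is_optimal_policy (fun pi => value P Z0 u pt pi mstar) Pi pistar)
    (delta : R) (hdelta : 0 < delta <= expR (-1)) :
  let C := util_max u in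
  prob_at_least P
    [set w |
      let D := fun i => observe pt (Z i w) in
      (value P Z0 u pt pistar mstar - value P Z0 u pt (pihat D) mstar <=
       (2 * C)%:E *
         emp_width (fun i => obs_x (D i)) (Mhat D)
           (fun a x => pol R pistar x a * (1 - pol R pt x a))%R +
       (6 * C * (K - 1)%:R)%:E *
         (\big[maxe/-oo]_(a < K)
            rademacher_complexity P (fun i w' => covariate (Z i w'))
              (policy_slice Pi a) +
          (2 * Num.sqrt (n%:R^-1 * ln ((K - 1)%:R / delta)))%:E))%E]
    (1 - alpha - delta).
Proof.
move=> C.
have mm a : measurable_fun [set: X] (mstar a) by have [] := hmstar a.
have m01 a x : 0 <= mstar a x <= 1 by have [Fm _] := hM; exact: hF.
have [Pstar _] := hpistar.
have K0 : (0 < K)%N by exact: ltnW.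
pose a0 : 'I_K := Ordinal K0.
have uC : ubar <= 2 * C by rewrite -(hu a0); exact: util_diff_le_max.
have C0 : 0 < C by lra.
pose v := policy_value u pt mstar.
have bv pi : Pi pi -> bounded_measurable (v pi).
  by move=> /hPi; exact: bmf_policy_value.
pose Rad a := rademacher_complexity P (fun i w' => covariate (Z i w'))
  (policy_slice Pi a : set (X -> R)).
have Rad01 a : (0 <= Rad a <= 1)%E.
  apply: (rademacher_complexity01 P hn Z (@covariate X K)).
    by exists (fun y => pol R pistar y a); exists pistar.
  by move=> g t [pi _ <-]; exact: pol01.
(* The complexities lie in [0, 1] and there is at least one action, so the maximum is a real
   number. *)
have [Rm [RmE Rm0 RmP]] : exists Rm : R,
    [/\ \big[maxe/-oo%E]_(a < K) Rad a = Rm%:E, 0 <= Rm &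
        forall a, (Rad a <= Rm%:E)%E].
  have Rle a : (Rad a <= \big[maxe/-oo%E]_(a < K) Rad a)%E by exact: le_bigmax.
  have b0 : (0 <= \big[maxe/-oo%E]_(a < K) Rad a)%E.
    by apply: le_trans (Rle a0); have /andP[] := Rad01 a0.
  have b1 : (\big[maxe/-oo%E]_(a < K) Rad a <= 1)%E.
    by apply: bigmax_le => [|a _]; first exact: leNye; have /andP[] := Rad01 a.
  have bE : \big[maxe/-oo%E]_(a < K) Rad a \is a fin_num.
    by rewrite ge0_fin_numE// (le_lt_trans b1)// ltry.
  exists (fine (\big[maxe/-oo%E]_(a < K) Rad a)).
  by rewrite fineK//; split=> //; rewrite fine_ge0.
have /andP[d0 d1] := hdelta.
have K1 : 1 <= ((K - 1)%:R : R) by rewrite ler1n subn_gt0.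
have KE : (K%:R : R) = (K - 1)%:R + 1.
  by rewrite -[in LHS](subnK (ltnW hK)) natrD.
set k : R := (K - 1)%:R in K1 KE *.
have n0 : 0 < (n%:R : R) by rewrite ltr0n.
set x := Num.sqrt (n%:R^-1 * ln (k / delta)).
have kd : 1 < k / delta.
  rewrite ltr_pdivlMr// mul1r; apply: le_lt_trans d1 _.
  by apply: lt_le_trans K1; rewrite -expR0 ltr_expR.
have L0 : 0 < n%:R^-1 * ln (k / delta) by rewrite mulr_gt0 ?invr_gt0// ln_gt0.
have x0 : 0 < x by rewrite sqrtr_gt0.
(* By the choice of [x] the left side is delta / (K - 1), and K >= 2. *)
have tail : expR (- (n%:R * x ^+ 2)) <= delta.
  rewrite sqr_sqrtr; last exact: ltW.
  rewrite mulrA mulfV ?gt_eqF// mul1r expRN lnK; last first.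
    by rewrite posrE (lt_trans _ kd).
  rewrite invf_div ler_pdivrMr; last exact: lt_le_trans K1.
  by rewrite ler_peMr// ltW.
have [E1 [mE1 E1M PE1]] := hMhat.
have [E2 [mE2 PE2 E2P]] := policy_deviation hn hZ hpt mm m01 hPi C0 Pstar x0 RmP.
exists (E1 `&` E2); split; first exact: measurableI.
- move=> w [/E1M/= sub E2w] /=.
  set D := fun i => observe pt (Z i w).
  have safe := hpihat w; rewrite -/D in safe.
  have Mm : Mhat D mstar by exact: sub.
  have [Phat _] := safe.
  (* [E2] controls all policies of [Pi] simultaneously, so the data-dependent [pihat D] may be
     inserted. *)
  have dev := E2P w _ E2w Phat.
  have reg := emp_regret_width hubar hu safe Pstar Mm.
  rewrite !valueE; [|exact: bv..].
  rewrite RmE.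
  set W := emp_width _ _ _ in reg *.
  have W0 : (0 <= W)%E by apply: emp_width_ge0; exists mstar.
  have empE pi : emp_value u pt D pi mstar = n%:R^-1 * \sum_(i < n) v pi (Z i w).
    by [].
  rewrite !empE -mulrBr -sumrB in reg.
  set e := n%:R^-1 * _ in reg dev *.
  apply: (@le_trans _ _ (ubar%:E * W +
      (6 * C * k * (Rm + 2 * x))%:E)%E); last first.
    rewrite -EFinD -EFinM; apply: leeD => //.
    by apply: lee_wpmul2r.
  apply: le_trans (leeD reg (lexx _)).
  rewrite -EFinB -EFinD lee_fin -lerBlDl; apply: le_trans dev _.
  rewrite KE.
  have kR : 0 <= (k - 1) * Rm by rewrite mulr_ge0 ?subr_ge0.
  have kx : 0 <= (k - 1) * x by rewrite mulr_ge0 ?subr_ge0// ltW.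
  (* With k = K - 1 >= 1: 2 (k + 1) <= 6 k for [Rm], and 2 k + 10 <= 12 k for [x], the latter with
     equality at k = 1. *)
  have : 2 * (k + 1) * (Rm + x) + 8 * x <= 6 * k * (Rm + 2 * x) by lra.
  move=> /(ler_wpM2l (ltW C0)); rewrite -/C; lra.
- have mE2c : measurable (~` E2) by exact: measurableC.
  have PE1E : P E1 = (fine (P E1))%:E by rewrite fineK// fin_num_measure.
  have PE2E : P E2 = (1 - fine (P (~` E2)))%:E.
    rewrite -[E2 in LHS]setCK probability_setC// EFinB fineK//.
    by rewrite fin_num_measure.
  have PE2' : fine (P (~` E2)) <= delta.
    rewrite -lee_fin fineK ?fin_num_measure//.
    by apply: le_trans PE2 _; rewrite lee_fin.
  (* Union bound: coverage by the model class fails with probability at most alpha, the deviation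
     bound with at most delta. *)
  have sub : (P E1 <= P (E1 `&` E2) + P (~` E2))%E.
    apply: le_trans (measureU2 _ _ _) => //; last exact: measurableI.
    apply: le_measure; rewrite ?inE//.
      by apply: measurableU => //; exact: measurableI.
    by move=> w E1w; have [|] := pselect (E2 w); [left | right].
  have PIE : P (E1 `&` E2) = (fine (P (E1 `&` E2)))%:E.
    by rewrite fineK// fin_num_measure//; exact: measurableI.
  have PcE : P (~` E2) = (fine (P (~` E2)))%:E.
    by rewrite fineK// fin_num_measure.
  move: PE1 sub; rewrite PIE PE1E PcE -EFinD !lee_fin; lra.
Qed.
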